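(* Let $C_n$ be a primitive multiple curve of multiplicity $n$ with associated reduced curve $C$, and let $\mathcal{E}$ be a quasi locally free sheaf on $C_n$. Then there exist a vector bundle $\mathbb{E}$ on $C_n$ and a surjective morphism $\mathbb{E}\to\mathcal{E}$ inducing an isomorphism $\mathbb{E}_{|C}\simeq\mathcal{E}_{|C}$.
   Context: We work over $\mathbb{C}$. A primitive multiple curve is a Cohen–Macaulay complex algebraic variety (scheme of finite type, not necessarily reduced) $C_n$ such that the reduced subscheme $C=(C_n)_{red}$ is a smooth irreducible curve and every closed point has a neighbourhood that can be embedded in a smooth surface $S$; its multiplicity is the integer $n$ such that locally, if $z$ generates the ideal of $C$ in $\mathcal{O}_{S,P}$, the ideal of $C_n$ is $(z^n)$. Let $\mathcal{I}_C$ be the ideal sheaf of $C$ in $C_n$ and $C_i\subset C_n$ the closed subscheme defined by $\mathcal{I}_C^i$, $1\le i\le n$. A coherent sheaf on $C_n$ is quasi locally free if there are integers $m_1,\dots,m_n\ge0$ such that it is locally isomorphic to $\bigoplus_{i=1}^n m_i\mathcal{O}_{C_i}$. A vector bundle is a locally free sheaf of finite rank. *)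

(* Defs.v *)
From HB Require Import structures.
From mathcomp Require Import all_boot all_order all_algebra.
From mathcomp Require Import boolp classical_sets functions reals topology.
From mathcomp Require Import complex generic_quotient.

Set Implicit Arguments.
Unset Strict Implicit.
Unset Printing Implicit Defensive.

Import GRing.Theory.
Local Open Scope classical_set_scope.
Local Open Scope quotient_scope.
Local Open Scope ring_scope.

(** * Ringed spaces and sheaves of modules *)

Record opens (T : topologicalType) := Opens {
  opens_set :> T -> Prop;
  opens_open : open (opens_set : set T)
}.

Definition subo (T : topologicalType) (V U : opens T) : Prop :=
  (V : set T) `<=` (U : set T).

Lemma subo_refl (T : topologicalType) (U : opens T) : subo U U.
Proof. by move=> x. Qed.

Lemma subo_trans (T : topologicalType) (V U W : opens T) :
  subo U V -> subo V W -> subo U W.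
Proof. by move=> h k x /h /k. Qed.

Definition opensI (T : topologicalType) (U V : opens T) : opens T :=
  Opens (openI (opens_open U) (opens_open V)).

Lemma suboIl (T : topologicalType) (U V : opens T) : subo (opensI U V) U.
Proof. by move=> x []. Qed.

Lemma suboIr (T : topologicalType) (U V : opens T) : subo (opensI U V) V.
Proof. by move=> x []. Qed.

Definition opensT (T : topologicalType) : opens T := Opens (@openT T).

(* Rings of sections may be zero (e.g. over the empty open set), hence [Pz].
   The laws of [res] hold for all inclusion proofs, so that its value does not
   depend on the proof. *)
Record ringedSpace (K : comPzRingType) := RingedSpace {
  space :> topologicalType;
  OX : opens space -> comPzRingType;
  cst : forall U, {rmorphism K -> OX U};
  res : forall U V, subo V U -> {rmorphism OX U -> OX V};
  res_cst : forall U V (h : subo V U) c, res h (cst U c) = cst V c;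
  res_id : forall U (h : subo U U) s, res h s = s;
  res_comp : forall U V W (h : subo V U) (k : subo W V) (l : subo W U) s,
    res k (res h s) = res l s;
  res_sep : forall U (s t : OX U),
    (forall x, U x -> exists V (h : subo V U), V x /\ res h s = res h t) ->
    s = t;
  res_glue : forall U (I : Type) (W : I -> opens space)
      (h : forall i, subo (W i) U) (s : forall i, OX (W i)),
    (forall x, U x -> exists i, W i x) ->
    (forall i j V (hi : subo V (W i)) (hj : subo V (W j)),
       res hi (s i) = res hj (s j)) ->
    exists t : OX U, forall i, res (h i) t = s i
}.

Record sheafMod (K : comPzRingType) (X : ringedSpace K) := SheafMod {
  sec :> forall U : opens X, lmodType (OX U);
  mres : forall U V, subo V U -> sec U -> sec V;
  mresD : forall U V (h : subo V U) s t, mres h (s + t) = mres h s + mres h t;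
  mresZ : forall U V (h : subo V U) (a : OX U) s,
    mres h (a *: s) = res h a *: mres h s;
  mres_id : forall U (h : subo U U) s, mres h s = s;
  mres_comp : forall U V W (h : subo V U) (k : subo W V) (l : subo W U) s,
    mres k (mres h s) = mres l s;
  mres_sep : forall U (s t : sec U),
    (forall x, U x -> exists V (h : subo V U), V x /\ mres h s = mres h t) ->
    s = t;
  mres_glue : forall U (I : Type) (W : I -> opens X)
      (h : forall i, subo (W i) U) (s : forall i, sec (W i)),
    (forall x, U x -> exists i, W i x) ->
    (forall i j V (hi : subo V (W i)) (hj : subo V (W j)),
       mres hi (s i) = mres hj (s j)) ->
    exists t : sec U, forall i, mres (h i) t = s i
}.

Section ModuleBasics.
Context (K : comPzRingType) (X : ringedSpace K).

Lemma mres0 (E : sheafMod X) U V (h : subo V U) : mres h (0 : E U) = 0.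
Proof. by apply: (addrI (mres h 0)); rewrite -mresD !addr0. Qed.

Lemma mresN (E : sheafMod X) U V (h : subo V U) (s : E U) :
  mres h (- s) = - mres h s.
Proof. by apply: (addrI (mres h s)); rewrite -mresD !subrr mres0. Qed.

Lemma mresB (E : sheafMod X) U V (h : subo V U) (s t : E U) :
  mres h (s - t) = mres h s - mres h t.
Proof. by rewrite mresD mresN. Qed.

Definition structMod : sheafMod X :=
  @SheafMod K X (fun U => (OX U)^o) (fun U V h => res h)
    (fun U V h => rmorphD (res h)) (fun U V h => rmorphM (res h))
    (@res_id _ X) (@res_comp _ X) (@res_sep _ X) (@res_glue _ X).

Record modMor (E F : sheafMod X) := ModMor {
  mor :> forall U, {linear E U -> F U};
  mor_res : forall U V (h : subo V U) (s : E U),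
    mor V (mres h s) = mres h (mor U s)
}.

Definition sheaf_surjective (E F : sheafMod X) (f : modMor E F) : Prop :=
  forall U (t : F U) x, U x ->
    exists V (h : subo V U), V x /\ exists s : E V, f V s = mres h t.

Definition sheaf_iso (E F : sheafMod X) (f : modMor E F) : Prop :=
  forall U, bijective (f U).

(* E|_U and F|_U are isomorphic as modules over the sheaf of rings O_X|_U. *)
Definition isomorphic_on (U : opens X) (E F : sheafMod X) : Prop :=
  exists f : forall V, subo V U -> {linear E V -> F V},
    (forall V (h : subo V U), bijective (f V h)) /\
    (forall V W (h : subo V U) (k : subo W U) (l : subo W V) (s : E V),
       f W k (mres l s) = mres l (f V h s)).

Record subMod (E : sheafMod X) := SubMod {
  smem :> forall U, E U -> Prop;
  smem0 : forall U, smem (0 : E U);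
  smemD : forall U (s t : E U), smem s -> smem t -> smem (s + t);
  smemZ : forall U (a : OX U) (s : E U), smem s -> smem (a *: s);
  smem_res : forall U V (h : subo V U) (s : E U), smem s -> smem (mres h s);
  smem_loc : forall U (s : E U),
    (forall x, U x -> exists V (h : subo V U), V x /\ smem (mres h s)) -> smem s
}.

Lemma smemN (E : sheafMod X) (G : subMod E) U (s : E U) : G U s -> G U (- s).
Proof. by move=> Gs; rewrite -scaleN1r; apply: smemZ. Qed.

Lemma smemB (E : sheafMod X) (G : subMod E) U (s t : E U) :
  G U s -> G U t -> G U (s - t).
Proof. by move=> Gs Gt; apply: smemD => //; apply: smemN. Qed.

End ModuleBasics.

(** * Quotient sheaves *)

Section Quotient.
Context (K : comPzRingType) (X : ringedSpace K) (E : sheafMod X) (G : subMod E).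

(* A section over U of the quotient sheaf E/G (the sheafification of
   V |-> E(V)/G(V)) is encoded by the set of its representatives: [qrep V s]
   says that V lies in U and that s in E(V) represents the section over V.  This
   is a G-coset in E that is a sheaf and is locally nonempty.  The lemmas
   [quot_projP], [quot_proj_eq0] show that E/G is the cokernel of G -> E. *)
Record qsec (U : opens X) := QSec {
  qrep :> forall V, E V -> Prop;
  qrep_sub : forall V (s : E V), qrep s -> subo V U;
  qrep_res : forall V W (h : subo W V) (s : E V), qrep s -> qrep (mres h s);
  qrep_loc : forall V (s : E V), subo V U ->
    (forall x, V x -> exists W (h : subo W V), W x /\ qrep (mres h s)) ->
    qrep s;
  qrepB : forall V (s t : E V), qrep s -> qrep t -> G V (s - t);
  qrepD : forall V (s g : E V), qrep s -> G V g -> qrep (s + g);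
  qrep_ex : forall x, U x -> exists V (s : E V), V x /\ qrep s
}.

Lemma qsec_ext U (p q : qsec U) :
  (forall V (s : E V), p V s <-> q V s) -> p = q.
Proof.
case: p q => [p p1 p2 p3 p4 p5 p6] [q q1 q2 q3 q4 q5 q6] /= pq.
have e : p = q by apply: functional_extensionality_dep => V; apply/funext => s; apply/propext.
by subst q; congr QSec; apply: Prop_irrelevance.
Qed.

Lemma qrep_eqr U (p : qsec U) V (s t : E V) : p V s -> G _ (s - t) -> p V t.
Proof.
move=> ps Gst; have -> : t = s + - (s - t) by rewrite opprB addrC subrK.
by apply: qrepD => //; apply: smemN.
Qed.

Lemma qsec_eq U (p q : qsec U) :
  (forall x, U x -> exists V (s : E V), [/\ V x, p V s & q V s]) -> p = q.
Proof.
have main (p' q' : qsec U) :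
    (forall x, U x -> exists V (s : E V), [/\ V x, p' V s & q' V s]) ->
    forall V (s : E V), p' V s -> q' V s.
  move=> H V s ps; apply: qrep_loc; first exact: qrep_sub ps.
  move=> x Vx; have [W [t [Wx pt qt]]] := H x (qrep_sub ps Vx).
  exists (opensI V W), (@suboIl _ V W); split; first by split.
  apply: (@qrep_eqr _ _ _ (mres (@suboIr _ V W) t)); first exact: qrep_res.
  by apply: (@qrepB _ p'); apply: qrep_res.
move=> H; apply: qsec_ext => V s; split; first exact: main.
by apply: main => x Ux; have [W [t [? ? ?]]] := H x Ux; exists W, t.
Qed.

(* The section with prescribed local representatives P. *)
Section Glue.
Context (U : opens X) (P : forall V, E V -> Prop).
Arguments P {V}.
Hypothesis Psub : forall V (s : E V), P s -> subo V U.
Hypothesis Pcompat : forall V W N (h : subo N V) (k : subo N W)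
  (s : E V) (t : E W), P s -> P t -> G _ (mres h s - mres k t).
Hypothesis Pex : forall x, U x -> exists V (s : E V), V x /\ P s.

Definition qglue_rep V (s : E V) : Prop := subo V U /\
  forall x, V x -> exists W (h : subo W V) W' (k : subo W W') (t : E W'),
    [/\ W x, P t & G _ (mres h s - mres k t)].

Lemma qglue_rep_sub V (s : E V) : qglue_rep s -> subo V U.
Proof. by case. Qed.

Lemma qglue_rep_res V W (h : subo W V) (s : E V) :
  qglue_rep s -> qglue_rep (mres h s).
Proof.
move=> [VU H]; split; first exact: subo_trans h VU.
move=> x Wx; have [N [k [M [l [t [Nx Pt Gst]]]]]] := H x (h x Wx).
exists (opensI N W), (@suboIr _ N W), M, (subo_trans (@suboIl _ N W) l), t.
split=> //.
rewrite (mres_comp h _ (subo_trans (@suboIl _ N W) k)).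
rewrite -(mres_comp k (@suboIl _ N W)) -(mres_comp l (@suboIl _ N W)) -mresB.
exact: smem_res.
Qed.

Lemma qglue_rep_loc V (s : E V) : subo V U ->
  (forall x, V x -> exists W (h : subo W V), W x /\ qglue_rep (mres h s)) ->
  qglue_rep s.
Proof.
move=> VU H; split=> // x Vx; have [W [h [Wx [_ /(_ x Wx)]]]] := H x Vx.
move=> [N [k [M [l [t [Nx Pt Gst]]]]]].
exists N, (subo_trans k h), M, l, t; split=> //.
by rewrite -(mres_comp h k).
Qed.

Lemma qglue_repB V (s t : E V) : qglue_rep s -> qglue_rep t -> G _ (s - t).
Proof.
move=> [VU Hs] [_ Ht]; apply: smem_loc => x Vx.
have [W [h [W' [k [s' [Wx Ps Gs]]]]]] := Hs x Vx.
have [N [i [N' [j [t' [Nx Pt Gt]]]]]] := Ht x Vx.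
have a : subo (opensI W N) V := subo_trans (@suboIl _ W N) h.
exists (opensI W N), a; split; first by split.
pose b := @suboIl _ W N; pose c := @suboIr _ W N.
have Gs' : G _ (mres a s - mres (subo_trans b k) s').
  by rewrite -(mres_comp h b a) -(mres_comp k b) -mresB; apply: smem_res.
have Gt' : G _ (mres a t - mres (subo_trans c j) t').
  by rewrite -(mres_comp i c a) -(mres_comp j c) -mresB; apply: smem_res.
have Gst := Pcompat (subo_trans b k) (subo_trans c j) Ps Pt.
move: Gs' Gt' Gst; set u := mres _ s'; set v := mres _ t' => Gs' Gt' Gst.
have -> : mres a (s - t) = (mres a s - u) + (u - v) - (mres a t - v).
  by rewrite opprB !subrKA mresB.
by apply: smemB => //; apply: smemD.
Qed.

Lemma qglue_repD V (s g : E V) : qglue_rep s -> G V g -> qglue_rep (s + g).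
Proof.
move=> [VU H] Gg; split=> // x /H [W [h [W' [k [t [Wx Pt Gst]]]]]].
exists W, h, W', k, t; split=> //; rewrite mresD addrAC.
by apply: smemD => //; apply: smem_res.
Qed.

Lemma qglue_rep_in V (s : E V) : P s -> qglue_rep s.
Proof.
move=> Ps; split; first exact: Psub Ps.
move=> x Vx; exists V, (@subo_refl _ V), V, (@subo_refl _ V), s; split=> //.
by rewrite subrr; apply: smem0.
Qed.

Lemma qglue_rep_ex x : U x -> exists V (s : E V), V x /\ qglue_rep s.
Proof.
by move=> /Pex [V [s [Vx Ps]]]; exists V, s; split=> //; apply: qglue_rep_in.
Qed.

Definition qglue : qsec U :=
  QSec qglue_rep_sub qglue_rep_res qglue_rep_loc qglue_repB qglue_repD
    qglue_rep_ex.

End Glue.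

Lemma qrep2 U (p q : qsec U) x : U x ->
  exists V (s t : E V), [/\ V x, p V s & q V t].
Proof.
move=> Ux; have [V [s [Vx ps]]] := qrep_ex p Ux.
have [W [t [Wx qt]]] := qrep_ex q Ux.
exists (opensI V W), (mres (@suboIl _ V W) s), (mres (@suboIr _ V W) t).
by split=> //; apply: qrep_res.
Qed.

Lemma qrep3 U (p q r : qsec U) x : U x ->
  exists V (s t u : E V), [/\ V x, p V s, q V t & r V u].
Proof.
move=> Ux; have [V [s [t [Vx ps qt]]]] := qrep2 p q Ux.
have [W [u [Wx ru]]] := qrep_ex r Ux.
exists (opensI V W), (mres (@suboIl _ V W) s), (mres (@suboIl _ V W) t),
  (mres (@suboIr _ V W) u).
by split=> //; apply: qrep_res.
Qed.

(* The class in (E/G)(U) of a section of E over U. *)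
Section Proj.
Context (U : opens X) (s0 : E U).
Let P V (s : E V) := exists h : subo V U, s = mres h s0.

Lemma qproj_sub V (s : E V) : P s -> subo V U.
Proof. by case. Qed.

Lemma qproj_compat V W N (h : subo N V) (k : subo N W) (s : E V) (t : E W) :
  P s -> P t -> G _ (mres h s - mres k t).
Proof.
move=> [i ->] [j ->]; rewrite (mres_comp i h (subo_trans h i)).
by rewrite (mres_comp j k (subo_trans h i)) subrr; apply: smem0.
Qed.

Lemma qproj_ex x : U x -> exists V (s : E V), V x /\ P s.
Proof.
by move=> Ux; exists U, (mres (@subo_refl _ U) s0); split=> //; exists (@subo_refl _ U).
Qed.

Definition qproj : qsec U := qglue qproj_sub qproj_compat qproj_ex.

Lemma qproj_in V (h : subo V U) : qproj V (mres h s0).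
Proof. by apply: (qglue_rep_in qproj_sub); exists h. Qed.

End Proj.

Lemma qproj_inT U (s : E U) : qproj s U s.
Proof. by rewrite -{2}(mres_id (@subo_refl _ U) s); apply: qproj_in. Qed.

Section Add.
Context (U : opens X) (p q : qsec U).
Let P V (s : E V) := exists s1 s2 : E V, [/\ p V s1, q V s2 & s = s1 + s2].

Lemma qadd_sub V (s : E V) : P s -> subo V U.
Proof. by move=> [s1 [s2 [/qrep_sub]]]. Qed.

Lemma qadd_compat V W N (h : subo N V) (k : subo N W) (s : E V) (t : E W) :
  P s -> P t -> G _ (mres h s - mres k t).
Proof.
move=> [s1 [s2 [ps qs ->]]] [t1 [t2 [pt qt ->]]].
by rewrite !mresD opprD addrACA; apply: smemD;
  [apply: (@qrepB _ p)|apply: (@qrepB _ q)]; apply: qrep_res.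
Qed.

Lemma qadd_ex x : U x -> exists V (s : E V), V x /\ P s.
Proof.
move=> /(qrep2 p q) [V [s [t [Vx ps qt]]]]; exists V, (s + t).
by split=> //; exists s, t.
Qed.

Definition qadd : qsec U := qglue qadd_sub qadd_compat qadd_ex.

Lemma qadd_in V (s t : E V) : p V s -> q V t -> qadd V (s + t).
Proof. by move=> ps qt; apply: (qglue_rep_in qadd_sub); exists s, t. Qed.

End Add.

Section Opp.
Context (U : opens X) (p : qsec U).
Let P V (s : E V) := p V (- s).

Lemma qopp_sub V (s : E V) : P s -> subo V U.
Proof. exact: qrep_sub. Qed.

Lemma qopp_compat V W N (h : subo N V) (k : subo N W) (s : E V) (t : E W) :
  P s -> P t -> G _ (mres h s - mres k t).
Proof.
move=> ps pt; have -> : mres h s - mres k t = - (mres h (- s) - mres k (- t)).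
  by rewrite !mresN opprB opprK addrC.
by apply: smemN; apply: (@qrepB _ p); apply: qrep_res.
Qed.

Lemma qopp_ex x : U x -> exists V (s : E V), V x /\ P s.
Proof.
move=> /(qrep_ex p) [V [s [Vx ps]]]; exists V, (- s).
by split=> //; rewrite /P opprK.
Qed.

Definition qopp : qsec U := qglue qopp_sub qopp_compat qopp_ex.

Lemma qopp_in V (s : E V) : p V s -> qopp V (- s).
Proof. by move=> ps; apply: (qglue_rep_in qopp_sub); rewrite /P opprK. Qed.

End Opp.

Section Scale.
Context (U : opens X) (a : OX U) (p : qsec U).
Let P V (s : E V) := exists (h : subo V U) (t : E V), p V t /\ s = res h a *: t.

Lemma qscale_sub V (s : E V) : P s -> subo V U.
Proof. by case. Qed.

Lemma qscale_compat V W N (h : subo N V) (k : subo N W) (s : E V) (t : E W) :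
  P s -> P t -> G _ (mres h s - mres k t).
Proof.
move=> [i [s' [ps ->]]] [j [t' [pt ->]]]; rewrite !mresZ.
rewrite (res_comp i h (subo_trans h i)) (res_comp j k (subo_trans h i)).
by rewrite -scalerBr; apply: smemZ; apply: (@qrepB _ p); apply: qrep_res.
Qed.

Lemma qscale_ex x : U x -> exists V (s : E V), V x /\ P s.
Proof.
move=> /(qrep_ex p) [V [s [Vx ps]]]; exists V, (res (qrep_sub ps) a *: s).
by split=> //; exists (qrep_sub ps), s.
Qed.

Definition qscale : qsec U := qglue qscale_sub qscale_compat qscale_ex.

Lemma qscale_in V (h : subo V U) (s : E V) :
  p V s -> qscale V (res h a *: s).
Proof. by move=> ps; apply: (qglue_rep_in qscale_sub); exists h, s. Qed.

End Scale.

HB.instance Definition _ U := gen_eqMixin (qsec U).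
HB.instance Definition _ U := gen_choiceMixin (qsec U).

Lemma qaddA U : associative (@qadd U).
Proof.
move=> p q r; apply: qsec_eq => x /(qrep3 p q r) [V [s [t [u [Vx ps qt ru]]]]].
exists V, (s + (t + u)); split=> //; first by do 2?[apply: qadd_in].
by rewrite addrA; do 2?[apply: qadd_in].
Qed.

Lemma qaddC U : commutative (@qadd U).
Proof.
move=> p q; apply: qsec_eq => x /(qrep2 p q) [V [s [t [Vx ps qt]]]].
exists V, (s + t); split=> //; first exact: qadd_in.
by rewrite addrC; apply: qadd_in.
Qed.

Lemma qadd0 U : left_id (qproj 0) (@qadd U).
Proof.
move=> p; apply: qsec_eq => x /(qrep_ex p) [V [s [Vx ps]]].
exists V, (0 + s); split=> //; last by rewrite add0r.
by apply: qadd_in => //; rewrite -(mres0 _ (qrep_sub ps)); apply: qproj_in.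
Qed.

Lemma qaddN U : left_inverse (qproj 0) (@qopp U) (@qadd U).
Proof.
move=> p; apply: qsec_eq => x /(qrep_ex p) [V [s [Vx ps]]].
exists V, (- s + s); split=> //; first by apply: qadd_in => //; apply: qopp_in.
by rewrite addNr -(mres0 _ (qrep_sub ps)); apply: qproj_in.
Qed.

HB.instance Definition _ U :=
  GRing.isZmodule.Build (qsec U) (@qaddA U) (@qaddC U) (@qadd0 U) (@qaddN U).

Lemma qscaleA U a b (p : qsec U) : qscale a (qscale b p) = qscale (a * b) p.
Proof.
apply: qsec_eq => x /(qrep_ex p) [V [s [Vx ps]]]; pose h := qrep_sub ps.
exists V, (res h a *: (res h b *: s)); split=> //.
  by do 2?[apply: qscale_in].
by rewrite scalerA -rmorphM; apply: qscale_in.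
Qed.

Lemma qscale1 U : left_id 1 (@qscale U).
Proof.
move=> p; apply: qsec_eq => x /(qrep_ex p) [V [s [Vx ps]]].
exists V, (res (qrep_sub ps) 1 *: s); split=> //; first exact: qscale_in.
by rewrite rmorph1 scale1r.
Qed.

Lemma qscaleDr U : right_distributive (@qscale U) +%R.
Proof.
move=> a p q; apply: qsec_eq => x /(qrep2 p q) [V [s [t [Vx ps qt]]]].
pose h := qrep_sub ps; exists V, (res h a *: (s + t)); split=> //.
  by apply: qscale_in; apply: qadd_in.
by rewrite scalerDr; apply: qadd_in; apply: qscale_in.
Qed.

Lemma qscaleDl U (p : qsec U) : {morph (@qscale U)^~ p : a b / a + b}.
Proof.
move=> a b; apply: qsec_eq => x /(qrep_ex p) [V [s [Vx ps]]].
pose h := qrep_sub ps; exists V, (res h (a + b) *: s); split=> //.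
  exact: qscale_in.
by rewrite rmorphD scalerDl; apply: qadd_in; apply: qscale_in.
Qed.

HB.instance Definition _ U :=
  GRing.Zmodule_isLmodule.Build (OX U) (qsec U) (@qscaleA U) (@qscale1 U)
    (@qscaleDr U) (@qscaleDl U).

Section Res.
Context (U V : opens X) (h : subo V U) (p : qsec U).
Let P W (s : E W) := subo W V /\ p W s.

Lemma qres_sub W (s : E W) : P s -> subo W V.
Proof. by case. Qed.

Lemma qres_compat W W' N (i : subo N W) (j : subo N W') (s : E W) (t : E W') :
  P s -> P t -> G _ (mres i s - mres j t).
Proof. by move=> [_ ps] [_ pt]; apply: (@qrepB _ p); apply: qrep_res. Qed.

Lemma qres_ex x : V x -> exists W (s : E W), W x /\ P s.
Proof.
move=> Vx; have [W [s [Wx ps]]] := qrep_ex p (h Vx).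
exists (opensI W V), (mres (@suboIl _ W V) s); split=> //; split=> //.
  exact: suboIr.
exact: qrep_res.
Qed.

Definition qres : qsec V := qglue qres_sub qres_compat qres_ex.

Lemma qresP W (s : E W) : qres W s <-> subo W V /\ p W s.
Proof.
split=> [[WV H]|[WV ps]]; last exact: (qglue_rep_in qres_sub).
split=> //; apply: qrep_loc; first exact: subo_trans WV h.
move=> x /H [N [k [N' [l [t [Nx [_ pt] Gst]]]]]]; exists N, k; split=> //.
apply: (@qrep_eqr _ _ _ (mres l t)); first exact: qrep_res.
by rewrite -opprB; apply: smemN.
Qed.

End Res.

Lemma qresD U V (h : subo V U) (p q : qsec U) :
  qres h (p + q) = qres h p + qres h q.
Proof.
apply: qsec_eq => x /(qrep2 (qres h p) (qres h q)) [W [s [t [Wx ps qt]]]].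
exists W, (s + t); split=> //; last exact: qadd_in.
move: ps qt => /qresP [WV ps] /qresP [_ qt]; apply/qresP; split=> //.
exact: qadd_in.
Qed.

Lemma qresZ U V (h : subo V U) a (p : qsec U) :
  qres h (a *: p) = res h a *: qres h p.
Proof.
apply: qsec_eq => x /(qrep_ex (qres h p)) [W [s [Wx ps]]].
have [WV ps'] := (qresP h p s).1 ps.
exists W, (res (subo_trans WV h) a *: s); split=> //.
  by apply/qresP; split=> //; apply: (@qscale_in U a p).
by rewrite -(res_comp h WV); apply: (@qscale_in V (res h a) (qres h p)).
Qed.

Lemma qres_id U (h : subo U U) (p : qsec U) : qres h p = p.
Proof.
apply: qsec_ext => V s; split=> [/qresP []//|ps].
by apply/qresP; split=> //; apply: qrep_sub ps.
Qed.

Lemma qres_comp U V W (h : subo V U) (k : subo W V) (l : subo W U) p :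
  qres k (qres h p) = qres l p.
Proof.
apply: qsec_ext => N s; split=> [/qresP [NW /qresP[_ ps]]|/qresP [NW ps]].
  by apply/qresP.
by apply/qresP; split=> //; apply/qresP; split=> //; apply: subo_trans NW k.
Qed.

Lemma qres_sep U (p q : qsec U) :
  (forall x, U x -> exists V (h : subo V U), V x /\ qres h p = qres h q) ->
  p = q.
Proof.
move=> H; apply: qsec_eq => x /H [V [h [Vx e]]].
have [W [s [Wx ps]]] := qrep_ex (qres h p) Vx; exists W, s; split=> //.
  by have /qresP [] := ps.
by move: ps; rewrite e => /qresP [].
Qed.

Lemma qres_glue U (I : Type) (W : I -> opens X) (h : forall i, subo (W i) U)
    (p : forall i, qsec (W i)) :
  (forall x, U x -> exists i, W i x) ->
  (forall i j V (hi : subo V (W i)) (hj : subo V (W j)),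
     qres hi (p i) = qres hj (p j)) ->
  exists t : qsec U, forall i, qres (h i) t = p i.
Proof.
move=> cov comp; pose P V (s : E V) := exists i, p i V s.
have Psub V (s : E V) : P V s -> subo V U.
  by move=> [i ps]; apply: subo_trans (qrep_sub ps) (h i).
have Pcompat V W' N (k : subo N V) (l : subo N W') (s : E V) (t : E W') :
    P V s -> P W' t -> G _ (mres k s - mres l t).
  move=> [i ps] [j pt]; apply: (@qrepB _ (p j)); last exact: qrep_res.
  have hi := subo_trans k (qrep_sub ps); have hj := subo_trans l (qrep_sub pt).
  have : qres hi (p i) N (mres k s).
    by apply/qresP; split; [apply: subo_refl|apply: qrep_res].
  by rewrite (comp _ _ _ hi hj) => /qresP [].
have Pex x : U x -> exists V (s : E V), V x /\ P V s.
  move=> /cov [i /(qrep_ex (p i)) [V [s [Vx ps]]]].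
  by exists V, s; split=> //; exists i.
exists (qglue Psub Pcompat Pex) => i; apply: qsec_eq => x Wx.
have [V [s [Vx ps]]] := qrep_ex (p i) Wx; exists V, s; split=> //.
apply/qresP; split; first exact: qrep_sub ps.
by apply: (qglue_rep_in Psub); exists i.
Qed.

Definition quotMod : sheafMod X :=
  @SheafMod K X (fun U => qsec U : lmodType (OX U)) qres qresD qresZ qres_id
    qres_comp qres_sep qres_glue.

Lemma qproj_linear U : linear (@qproj U).
Proof.
move=> a s t; apply: (@qsec_eq U) => x Ux.
exists U, (a *: s + t); split=> //; first exact: qproj_inT.
apply: (@qadd_in U (qscale a (qproj s)) (qproj t)); last exact: qproj_inT.
have := @qscale_in U a (qproj s) U (@subo_refl _ U) s (qproj_inT s).
by rewrite res_id.
Qed.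

HB.instance Definition _ U :=
  GRing.isLinear.Build (OX U) (E U) (qsec U) _ (@qproj U) (@qproj_linear U).

Lemma qproj_res U V (h : subo V U) (s : E U) :
  qproj (mres h s) = qres h (qproj s).
Proof.
apply: qsec_eq => x Vx; exists V, (mres h s); split=> //.
  exact: qproj_inT.
by apply/qresP; split; [apply: subo_refl|apply: qproj_in].
Qed.

Definition quot_proj : modMor E quotMod :=
  @ModMor K X E quotMod (fun U => @qproj U) qproj_res.

Lemma quot_projP : sheaf_surjective quot_proj.
Proof.
move=> U p x Ux; have [V [s [Vx ps]]] := qrep_ex p Ux.
exists V, (qrep_sub ps); split=> //; exists s; apply: qsec_eq => y Vy.
exists V, s; split=> //; first exact: qproj_inT.
by apply/qresP; split=> //; apply: subo_refl.
Qed.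

Lemma quot_proj_eq0 U (s : E U) : quot_proj U s = 0 <-> G U s.
Proof.
split=> [e|Gs].
  have : qproj s U s by apply: qproj_inT.
  have -> : qproj s = qproj 0 by exact: e.
  move=> s0; have := qrepB s0 (qproj_inT (0 : E U)).
  by rewrite subr0.
apply: (@qsec_eq U) => x Ux; exists U, s; split=> //; first exact: qproj_inT.
by apply: (@qrep_eqr _ _ _ 0); [exact: qproj_inT|rewrite sub0r; apply: smemN].
Qed.

End Quotient.

Section QuotientMap.
Context (K : comPzRingType) (X : ringedSpace K) (E F : sheafMod X).
Context (G : subMod E) (H : subMod F) (f : modMor E F).
Hypothesis fGH : forall U (s : E U), G U s -> H U (f U s).

Section Sections.
Context (U : opens X) (p : qsec G U).
Let P V (t : F V) := exists s, p V s /\ t = f V s.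

Lemma qmap_sub V (t : F V) : P t -> subo V U.
Proof. by move=> [s [/qrep_sub]]. Qed.

Lemma qmap_compat V W N (h : subo N V) (k : subo N W) (s : F V) (t : F W) :
  P s -> P t -> H _ (mres h s - mres k t).
Proof.
move=> [s' [ps ->]] [t' [pt ->]]; rewrite -!mor_res -linearB.
by apply: fGH; apply: (@qrepB _ _ _ _ _ p); apply: qrep_res.
Qed.

Lemma qmap_ex x : U x -> exists V (t : F V), V x /\ P t.
Proof.
by move=> /(qrep_ex p) [V [s [Vx ps]]]; exists V, (f V s); split=> //; exists s.
Qed.

Definition qmap : qsec H U := qglue qmap_sub qmap_compat qmap_ex.

Lemma qmap_in V (s : E V) : p V s -> qmap V (f V s).
Proof. by move=> ps; apply: (qglue_rep_in H qmap_sub); exists s. Qed.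

End Sections.

Lemma qmap_linear U : linear (@qmap U).
Proof.
move=> a p q; apply: qsec_eq => x /(qrep2 p q) [V [s [t [Vx ps qt]]]].
pose h := qrep_sub ps; exists V, (f V (res h a *: s + t)); split=> //.
  apply: (@qmap_in U (a *: p + q)).
  by apply: (@qadd_in _ _ _ _ U (a *: p) q) => //; apply: (@qscale_in _ _ _ _ U a p).
rewrite linearP; apply: (@qadd_in _ _ _ _ U (a *: qmap p) (qmap q)).
  by apply: (@qscale_in _ _ _ _ U a (qmap p)); apply: qmap_in.
exact: qmap_in.
Qed.

HB.instance Definition _ U :=
  GRing.isLinear.Build (OX U) (qsec G U) (qsec H U) _ (@qmap U) (@qmap_linear U).

Lemma qmap_res U V (h : subo V U) (p : qsec G U) :
  qmap (qres h p) = qres h (qmap p).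
Proof.
apply: qsec_eq => x /(qrep_ex (qres h p)) [W [s [Wx ps]]].
exists W, (f W s); split=> //; first exact: qmap_in.
by move: ps => /qresP [WV ps]; apply/qresP; split=> //; apply: qmap_in.
Qed.

(* The unique morphism E/G -> F/H compatible with f, see [quot_mapE]. *)
Definition quot_map : modMor (quotMod G) (quotMod H) :=
  @ModMor K X (quotMod G) (quotMod H) (fun U => @qmap U) qmap_res.

Lemma quot_mapE U (s : E U) :
  quot_map U (quot_proj G U s) = quot_proj H U (f U s).
Proof.
apply: (@qsec_eq _ _ _ _ U) => x Ux; exists U, (f U s); split=> //.
  by apply: qmap_in; apply: qproj_inT.
exact: qproj_inT.
Qed.

End QuotientMap.

(** * Ideal sheaves and closed subspaces *)

Section Ideals.
Context (K : comPzRingType) (X : ringedSpace K).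

Definition idealSheaf := subMod (structMod X).

Section Full.
Context (E : sheafMod X).

Definition fullMod : subMod E :=
  @SubMod K X E (fun U s => True) (fun U => I) (fun U s t _ _ => I)
    (fun U a s _ => I) (fun U V h s _ => I) (fun U s _ => I).

Lemma zero_loc U (s : E U) :
  (forall x, U x -> exists V (h : subo V U), V x /\ mres h s = 0) -> s = 0.
Proof.
move=> H; apply: mres_sep => x /H [V [h [Vx e]]].
by exists V, h; rewrite mres0.
Qed.

Lemma zero_res U V (h : subo V U) (s : E U) : s = 0 -> mres h s = 0.
Proof. by move=> ->; apply: mres0. Qed.

Lemma zeroD U (s t : E U) : s = 0 -> t = 0 -> s + t = 0.
Proof. by move=> -> ->; rewrite addr0. Qed.

Lemma zeroZ U (a : OX U) (s : E U) : s = 0 -> a *: s = 0.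
Proof. by move=> ->; rewrite scaler0. Qed.

Definition zeroMod : subMod E :=
  SubMod (fun U => erefl (0 : E U)) zeroD zeroZ zero_res zero_loc.

End Full.

Section Mul.
Context (J : idealSheaf) (E : sheafMod X) (G : subMod E).

Definition lin_comb U (s : E U) : Prop :=
  exists n (a : 'I_n -> OX U) (g : 'I_n -> E U),
    [/\ forall i, J U (a i), forall i, G U (g i) & s = \sum_i a i *: g i].

Definition imul U (s : E U) : Prop :=
  forall x, U x -> exists V (h : subo V U), V x /\ lin_comb (mres h s).

Lemma lin_comb_res U V (h : subo V U) (s : E U) :
  lin_comb s -> lin_comb (mres h s).
Proof.
move=> [n [a [g [Ja Gg ->]]]].
exists n, (fun i => res h (a i)), (fun i => mres h (g i)); split.
- by move=> i; apply: (@smem_res _ _ _ J _ _ h).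
- by move=> i; apply: smem_res.
rewrite (@big_morph _ _ (mres h) 0 +%R) ?mres0 //; last exact: mresD.
by apply: eq_bigr => i _; rewrite mresZ.
Qed.

Lemma imul0 U : imul (0 : E U).
Proof.
move=> x Ux; exists U, (@subo_refl _ U); split=> //.
exists 0%N, (fun=> 0), (fun=> 0); split; [by case|by case|].
by rewrite big_ord0 mres0.
Qed.

Lemma imulD U (s t : E U) : imul s -> imul t -> imul (s + t).
Proof.
move=> Is It x Ux; have [V [h [Vx Hs]]] := Is x Ux.
have [W [k [Wx Ht]]] := It x Ux; pose b := @suboIl _ V W; pose c := @suboIr _ V W.
exists (opensI V W), (subo_trans b h); split=> //.
move: (lin_comb_res b Hs) (lin_comb_res c Ht).
rewrite (mres_comp h b (subo_trans b h)) (mres_comp k c (subo_trans b h)).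
rewrite mresD => -[n [a [g [Ja Gg ->]]]] [m [a' [g' [Ja' Gg' ->]]]].
exists (n + m)%N, (fun i => match fintype.split i with inl j => a j | inr j => a' j end),
  (fun i => match fintype.split i with inl j => g j | inr j => g' j end); split.
- by move=> i; case: (fintype.split i).
- by move=> i; case: (fintype.split i).
rewrite big_split_ord /=; congr (_ + _); apply: eq_bigr => i _.
  by rewrite (unsplitK (inl i)).
by rewrite (unsplitK (inr i)).
Qed.

Lemma imulZ U (c : OX U) (s : E U) : imul s -> imul (c *: s).
Proof.
move=> Is x /Is [V [h [Vx [n [a [g [Ja Gg e]]]]]]]; exists V, h; split=> //.
exists n, a, (fun i => res h c *: g i); split=> //.
  by move=> i; apply: smemZ.
rewrite mresZ e scaler_sumr; apply: eq_bigr => i _.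
by rewrite !scalerA mulrC.
Qed.

Lemma imul_res U V (h : subo V U) (s : E U) : imul s -> imul (mres h s).
Proof.
move=> Is x Vx; have [W [k [Wx Hs]]] := Is x (h x Vx).
exists (opensI V W), (@suboIl _ V W); split=> //.
move: (lin_comb_res (@suboIr _ V W) Hs).
by rewrite (mres_comp h _ (subo_trans (@suboIl _ V W) h))
  (mres_comp k _ (subo_trans (@suboIl _ V W) h)).
Qed.

Lemma imul_loc U (s : E U) :
  (forall x, U x -> exists V (h : subo V U), V x /\ imul (mres h s)) -> imul s.
Proof.
move=> H x /H [V [h [Vx /(_ x Vx) [W [k [Wx Hs]]]]]].
by exists W, (subo_trans k h); split=> //; rewrite -(mres_comp h k).
Qed.

(* The submodule J.G of E generated by the products of sections. *)
Definition idealMul : subMod E := SubMod imul0 imulD imulZ imul_res imul_loc.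

End Mul.

Definition idealPow (J : idealSheaf) (i : nat) : idealSheaf :=
  iter i (@idealMul J (structMod X)) (fullMod (structMod X)).

Definition locally_nilpotent U (s : structMod X U) : Prop :=
  forall x, U x -> exists V (h : subo V U), V x /\ exists k, res h s ^+ k = 0.

Lemma nil0 U : locally_nilpotent (0 : structMod X U).
Proof.
move=> x Ux; exists U, (@subo_refl _ U); split=> //; exists 1%N.
by rewrite expr1 rmorph0.
Qed.

Lemma nil_exprD (A : comPzRingType) (a b : A) m n :
  a ^+ m = 0 -> b ^+ n = 0 -> (a + b) ^+ (m + n) = 0.
Proof.
move=> am bn; rewrite exprDn big1 // => i _; have [le|lt] := leqP n i.
  by rewrite -(subnK le) [b ^+ (_ + _)]exprD bn !mulr0 mul0rn.
have le : (m <= m + n - i)%N by rewrite -addnBA ?leq_addr // ltnW.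
by rewrite -(subnK le) exprD am mulr0 mul0r mul0rn.
Qed.

Lemma nilD U (s t : structMod X U) :
  locally_nilpotent s -> locally_nilpotent t -> locally_nilpotent (s + t).
Proof.
move=> Ns Nt x Ux; have [V [h [Vx [k sk]]]] := Ns x Ux.
have [W [l [Wx [m tm]]]] := Nt x Ux.
pose b := @suboIl _ V W; pose c := @suboIr _ V W; pose a := subo_trans b h.
exists (opensI V W), a; split=> //; exists (k + m)%N; rewrite rmorphD.
apply: nil_exprD; first by rewrite -(res_comp h b) -rmorphXn sk rmorph0.
by rewrite -(res_comp l c) -rmorphXn tm rmorph0.
Qed.

Lemma nilZ U (a : OX U) (s : structMod X U) :
  locally_nilpotent s -> locally_nilpotent (a *: s).
Proof.
move=> Ns x /Ns [V [h [Vx [k sk]]]]; exists V, h; split=> //; exists k.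
by rewrite [res h _]rmorphM exprMn sk mulr0.
Qed.

Lemma nil_res U V (h : subo V U) (s : structMod X U) :
  locally_nilpotent s -> locally_nilpotent (mres h s).
Proof.
move=> Ns x Vx; have [W [l [Wx [k sk]]]] := Ns x (h x Vx).
pose b := @suboIl _ V W; pose c := @suboIr _ V W.
exists (opensI V W), b; split=> //; exists k.
have -> : res b (mres h s) = res c (res l s).
  by rewrite (res_comp l c (subo_trans b h)); apply: res_comp.
by rewrite -rmorphXn sk rmorph0.
Qed.

Lemma nil_loc U (s : structMod X U) :
  (forall x, U x -> exists V (h : subo V U),
     V x /\ locally_nilpotent (mres h s)) -> locally_nilpotent s.
Proof.
move=> H x /H [V [h [Vx /(_ x Vx) [W [l [Wx [k sk]]]]]]].
exists W, (subo_trans l h); split=> //; exists k.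
by rewrite -(res_comp h l); apply: sk.
Qed.

(* The ideal sheaf of the reduced subscheme. *)
Definition nilradical : idealSheaf := SubMod nil0 nilD nilZ nil_res nil_loc.

End Ideals.

Section ClosedSubspace.
Context (K : comPzRingType) (X : ringedSpace K) (J : idealSheaf X).

Section Mul.
Context (U : opens X) (p q : qsec J U).
Let P V (s : structMod X V) :=
  exists s1 s2 : OX V, [/\ p V s1, q V s2 & s = s1 * s2].

Lemma qmul_sub V (s : structMod X V) : P s -> subo V U.
Proof. by move=> [s1 [s2 [/qrep_sub]]]. Qed.

Lemma qmul_compat V W N (h : subo N V) (k : subo N W)
    (s : structMod X V) (t : structMod X W) :
  P s -> P t -> J _ (mres h s - mres k t).
Proof.
move=> [s1 [s2 [ps qs ->]]] [t1 [t2 [pt qt ->]]].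
have J1 : J N (res h s1 - res k t1).
  by apply: (@qrepB _ _ _ _ _ p); [exact: (qrep_res h ps)|exact: (qrep_res k pt)].
have J2 : J N (res h s2 - res k t2).
  by apply: (@qrepB _ _ _ _ _ q); [exact: (qrep_res h qs)|exact: (qrep_res k qt)].
have -> : mres h (s1 * s2 : structMod X V) - mres k (t1 * t2 : structMod X W)
    = res h s2 *: (res h s1 - res k t1 : structMod X N)
      + res k t1 *: (res h s2 - res k t2 : structMod X N).
  rewrite /= !rmorphM /GRing.scale /= !mulrBr (mulrC (res h s2)).
  by rewrite (mulrC (res h s2)) subrKA.
by apply: smemD; apply: smemZ.
Qed.

Lemma qmul_ex x : U x -> exists V (s : structMod X V), V x /\ P s.
Proof.
move=> /(qrep2 p q) [V [s [t [Vx ps qt]]]]; exists V, ((s : OX V) * t).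
by split=> //; exists s, t.
Qed.

Definition qmul : qsec J U := qglue qmul_sub qmul_compat qmul_ex.

Lemma qmul_in V (s t : OX V) : p V s -> q V t -> qmul V (s * t).
Proof. by move=> ps qt; apply: (qglue_rep_in J qmul_sub); exists s, t. Qed.

End Mul.

Lemma qmulA U : associative (@qmul U).
Proof.
move=> p q r; apply: qsec_eq => x /(qrep3 p q r) [V [s [t [u [Vx ps qt ru]]]]].
exists V, ((s : OX V) * ((t : OX V) * u)); split=> //.
  by do 2?[apply: qmul_in].
by rewrite mulrA; do 2?[apply: qmul_in].
Qed.

Lemma qmulC U : commutative (@qmul U).
Proof.
move=> p q; apply: qsec_eq => x /(qrep2 p q) [V [s [t [Vx ps qt]]]].
exists V, ((s : OX V) * t); split=> //; first exact: qmul_in.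
by rewrite mulrC; apply: qmul_in.
Qed.

Definition qone U : qsec J U := @qproj K X (structMod X) J U (1 : OX U).

Lemma qone_in U V (h : subo V U) : qone U V (1 : OX V).
Proof. by rewrite -(rmorph1 (res h)); apply: (qproj_in J (1 : OX U) h). Qed.

Lemma qmul1 U : left_id (qone U) (@qmul U).
Proof.
move=> p; apply: qsec_eq => x /(qrep_ex p) [V [s [Vx ps]]].
exists V, (1 * (s : OX V)); split=> //; last by rewrite mul1r.
by apply: qmul_in => //; apply: qone_in; apply: qrep_sub ps.
Qed.

Lemma qmulDl U : left_distributive (@qmul U) +%R.
Proof.
move=> p q r; apply: qsec_eq => x /(qrep3 p q r) [V [s [t [u [Vx ps qt ru]]]]].
exists V, (((s : OX V) + t) * u); split=> //.
  apply: (@qmul_in U (p + q) r) => //.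
  by apply: (@qadd_in _ _ _ _ U p q).
rewrite mulrDl; apply: (@qadd_in _ _ _ _ U (qmul p r) (qmul q r)).
  exact: qmul_in.
exact: qmul_in.
Qed.

HB.instance Definition _ U :=
  GRing.Zmodule_isComPzRing.Build (qsec J U) (@qmulA U) (@qmulC U) (@qmul1 U)
    (@qmulDl U).

Definition qcst U (c : K) : qsec J U :=
  @qproj K X (structMod X) J U (cst U c).

Lemma qcst_in U V (h : subo V U) c : qcst U c V (cst V c).
Proof. by rewrite -(res_cst h); apply: (qproj_in J (cst U c : structMod X U) h). Qed.

Lemma qcst_additive U : zmod_morphism (@qcst U).
Proof. by move=> c d; rewrite /qcst rmorphB; apply: (linearB (@qproj _ _ _ J U)). Qed.

Lemma qcst_multiplicative U : monoid_morphism (@qcst U).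
Proof.
split=> [|c d]; first by rewrite /qcst rmorph1.
apply: (@qsec_eq _ _ _ _ U) => x Ux.
exists U, (cst U (c * d)); split=> //; first exact: (qcst_in (@subo_refl _ U)).
rewrite rmorphM; apply: (@qmul_in U (qcst U c) (qcst U d));
  exact: (qcst_in (@subo_refl _ U)).
Qed.

HB.instance Definition _ U :=
  GRing.isZmodMorphism.Build K (qsec J U) (@qcst U) (@qcst_additive U).
HB.instance Definition _ U :=
  GRing.isMonoidMorphism.Build K (qsec J U) (@qcst U) (@qcst_multiplicative U).

Section Res.
Context (U V : opens X) (h : subo V U).
Definition qresr : qsec J U -> qsec J V := qres h.

Lemma qresr_additive : zmod_morphism qresr.
Proof.
move=> p q; have e : qresr (p - q + q) = qresr (p - q) + qresr q.
  exact: (qresD h (p - q) q).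
by move: e; rewrite subrK => ->; rewrite addrK.
Qed.

Lemma qresr_multiplicative : monoid_morphism qresr.
Proof.
split=> [|p q].
  apply: qsec_eq => x Vx; exists V, (1 : OX V); split=> //.
    by apply/qresP; split; [apply: subo_refl|apply: qone_in].
  exact: (qone_in (@subo_refl _ V)).
apply: qsec_eq => x Vx; have [W [s [t [Wx ps qt]]]] := qrep2 (qresr p) (qresr q) Vx.
exists W, ((s : OX W) * t); split=> //; last exact: qmul_in.
move: ps qt => /qresP [WV ps] /qresP [_ qt].
by apply/qresP; split=> //; apply: qmul_in.
Qed.

HB.instance Definition _ :=
  GRing.isZmodMorphism.Build (qsec J U) (qsec J V) qresr qresr_additive.
HB.instance Definition _ :=
  GRing.isMonoidMorphism.Build (qsec J U) (qsec J V) qresr qresr_multiplicative.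
End Res.

Lemma qresr_cst U V (h : subo V U) c : qresr h (qcst U c) = qcst V c.
Proof.
apply: qsec_eq => x Vx; exists V, (cst V c); split=> //.
  by apply/qresP; split; [apply: subo_refl|apply: qcst_in].
exact: (qcst_in (@subo_refl _ V)).
Qed.

(* The ringed space (X, O_X/J).  It is the closed subspace defined by J when J
   is locally nilpotent; the support of O_X/J is then all of X. *)
Definition nilSubspace : ringedSpace K :=
  @RingedSpace K X (fun U => qsec J U : comPzRingType) (fun U => @qcst U)
    (fun U V h => qresr h) qresr_cst (@qres_id _ _ _ J) (@qres_comp _ _ _ J)
    (@qres_sep _ _ _ J) (@qres_glue _ _ _ J).

End ClosedSubspace.

(** * Direct sums *)

Section DirectSum.
Context (K : comPzRingType) (X : ringedSpace K) (I : finType).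
Context (F : I -> sheafMod X).

Definition dsec (U : opens X) : Type := forall i, F i U.

HB.instance Definition _ U := gen_eqMixin (dsec U).
HB.instance Definition _ U := gen_choiceMixin (dsec U).

Section Sections.
Context (U : opens X).
Let dfun (f g : dsec U) : (forall i, f i = g i) -> f = g :=
  @functional_extensionality_dep _ _ f g.

Lemma dsec_addA : associative (fun f g : dsec U => (fun i => f i + g i) : dsec U).
Proof. by move=> f g h; apply: dfun => i; rewrite addrA. Qed.

Lemma dsec_addC : commutative (fun f g : dsec U => (fun i => f i + g i) : dsec U).
Proof. by move=> f g; apply: dfun => i; rewrite addrC. Qed.

Lemma dsec_add0 : left_id ((fun i => 0) : dsec U) (fun f g : dsec U => fun i => f i + g i).
Proof. by move=> f; apply: dfun => i; rewrite add0r. Qed.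

Lemma dsec_addN : left_inverse ((fun i => 0) : dsec U)
  (fun f i => - f i) (fun f g : dsec U => fun i => f i + g i).
Proof. by move=> f; apply: dfun => i; rewrite addNr. Qed.

HB.instance Definition _ :=
  GRing.isZmodule.Build (dsec U) dsec_addA dsec_addC dsec_add0 dsec_addN.

Lemma dsec_scaleA (a b : OX U) (f : dsec U) :
  (fun i => a *: (b *: f i)) = (fun i => (a * b) *: f i) :> dsec U.
Proof. by apply: dfun => i; rewrite scalerA. Qed.

Lemma dsec_scale1 :
  left_id (1 : OX U) (fun a (f : dsec U) => (fun i => a *: f i) : dsec U).
Proof. by move=> f; apply: dfun => i; rewrite scale1r. Qed.

Lemma dsec_scaleDr :
  right_distributive (fun (a : OX U) (f : dsec U) => (fun i => a *: f i) : dsec U) +%R.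
Proof. by move=> a f g; apply: dfun => i; apply: scalerDr. Qed.

Lemma dsec_scaleDl (f : dsec U) :
  {morph (fun a : OX U => (fun i => a *: f i) : dsec U) : a b / a + b}.
Proof. by move=> a b; apply: dfun => i; apply: scalerDl. Qed.

HB.instance Definition _ :=
  GRing.Zmodule_isLmodule.Build (OX U) (dsec U) dsec_scaleA dsec_scale1
    dsec_scaleDr dsec_scaleDl.

End Sections.

Definition dres U V (h : subo V U) (f : dsec U) : dsec V := fun i => mres h (f i).

Lemma dresD U V (h : subo V U) (f g : dsec U) : dres h (f + g) = dres h f + dres h g.
Proof. by apply: functional_extensionality_dep => i; apply: mresD. Qed.

Lemma dresZ U V (h : subo V U) (a : OX U) (f : dsec U) :
  dres h (a *: f) = res h a *: dres h f.
Proof. by apply: functional_extensionality_dep => i; apply: mresZ. Qed.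

Lemma dres_id U (h : subo U U) (f : dsec U) : dres h f = f.
Proof. by apply: functional_extensionality_dep => i; apply: mres_id. Qed.

Lemma dres_comp U V W (h : subo V U) (k : subo W V) (l : subo W U) (f : dsec U) :
  dres k (dres h f) = dres l f.
Proof. by apply: functional_extensionality_dep => i; apply: mres_comp. Qed.

Lemma dres_sep U (f g : dsec U) :
  (forall x, U x -> exists V (h : subo V U), V x /\ dres h f = dres h g) -> f = g.
Proof.
move=> H; apply: functional_extensionality_dep => i; apply: mres_sep => x /H.
move=> [V [h [Vx e]]]; exists V, h; split=> //.
exact: (congr1 (fun u : dsec V => u i) e).
Qed.

Lemma dres_glue U (L : Type) (W : L -> opens X) (h : forall l, subo (W l) U)
    (s : forall l, dsec (W l)) :
  (forall x, U x -> exists l, W l x) ->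
  (forall l m V (hl : subo V (W l)) (hm : subo V (W m)),
     dres hl (s l) = dres hm (s m)) ->
  exists t : dsec U, forall l, dres (h l) t = s l.
Proof.
move=> cov comp.
have H i : exists t : F i U, forall l, mres (h l) t = s l i.
  apply: (@mres_glue _ _ (F i) U L W h (fun l => s l i)) => // l m V hl hm.
  exact: (congr1 (fun u : dsec V => u i) (comp l m V hl hm)).
exists (fun i => projT1 (cid (H i))) => l.
by apply: functional_extensionality_dep => i; apply: (projT2 (cid (H i))).
Qed.

Definition dsumMod : sheafMod X :=
  @SheafMod K X (fun U => dsec U : lmodType (OX U)) dres dresD dresZ dres_id
    dres_comp dres_sep dres_glue.

End DirectSum.

Definition freeMod (K : comPzRingType) (X : ringedSpace K) (r : nat) : sheafMod X :=
  dsumMod (fun _ : 'I_r => structMod X).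

(** * Stalks of the structure sheaf *)

Section Stalk.
Context (K : comPzRingType) (X : ringedSpace K) (x : X).

Record pgerm := PGerm { pdom : opens X; pdomP : pdom x; pval : OX pdom }.

HB.instance Definition _ := gen_eqMixin pgerm.
HB.instance Definition _ := gen_choiceMixin pgerm.

Definition same_germ (s t : pgerm) : Prop :=
  exists V (h : subo V (pdom s)) (k : subo V (pdom t)),
    V x /\ res h (pval s) = res k (pval t).

Definition germ_eqv (s t : pgerm) : bool := `[< same_germ s t >].

Lemma germ_eqv_refl : reflexive germ_eqv.
Proof.
move=> s; apply/asboolP; exists (pdom s), (@subo_refl _ _), (@subo_refl _ _).
by split=> //; apply: pdomP.
Qed.

Lemma germ_eqv_sym : symmetric germ_eqv.
Proof.
have H s t : germ_eqv s t -> germ_eqv t s.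
  by move=> /asboolP [V [h [k [Vx e]]]]; apply/asboolP; exists V, k, h.
by move=> s t; apply/idP/idP; apply: H.
Qed.

Lemma germ_eqv_trans : transitive germ_eqv.
Proof.
move=> t s u /asboolP [V [h [k [Vx e]]]] /asboolP [W [i [j [Wx f]]]].
pose b := @suboIl _ V W; pose c := @suboIr _ V W; apply/asboolP.
exists (opensI V W), (subo_trans b h), (subo_trans c j); split=> //.
rewrite -(res_comp h b) e (res_comp k b (subo_trans c i)) -(res_comp i c).
by rewrite f (res_comp j c (subo_trans c j)).
Qed.

Canonical germ_equiv :=
  EquivRel germ_eqv germ_eqv_refl germ_eqv_sym germ_eqv_trans.

(* The local ring O_{X,x}: the filtered colimit of O_X(U) over U containing x. *)
Definition stalk : Type := {eq_quot germ_equiv}.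

HB.instance Definition _ := Choice.on stalk.
HB.instance Definition _ := EqQuotient.on stalk.

Definition germ (U : opens X) (Ux : U x) (s : OX U) : stalk :=
  \pi_({eq_quot germ_equiv}) (PGerm Ux s).

Lemma germ_eqP (U V : opens X) (Ux : U x) (s : OX U) (Vx : V x) (t : OX V) :
  germ Ux s = germ Vx t <->
  exists W (h : subo W U) (k : subo W V), W x /\ res h s = res k t.
Proof.
split=> [|H]; last by apply/eqmodP/asboolP.
by move=> /eqmodP /asboolP.
Qed.

Lemma germ_res (U V : opens X) (Ux : U x) (Vx : V x) (h : subo V U) (s : OX U) :
  germ Vx (res h s) = germ Ux s.
Proof.
apply/germ_eqP; exists V, (@subo_refl _ V), h; split=> //.
exact: res_id.
Qed.

Lemma germ_surj (a : stalk) : exists (U : opens X) (Ux : U x) (s : OX U), a = germ Ux s.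
Proof.
by exists (pdom (repr a)), (pdomP (repr a)), (pval (repr a)); rewrite -[LHS]reprK;
  case: (repr a).
Qed.

Lemma germ_surj2 (a b : stalk) :
  exists (U : opens X) (Ux : U x) (s t : OX U), a = germ Ux s /\ b = germ Ux t.
Proof.
have [U [Ux [s ->]]] := germ_surj a; have [V [Vx [t ->]]] := germ_surj b.
exists (opensI U V), (conj Ux Vx), (res (@suboIl _ U V) s), (res (@suboIr _ U V) t).
by rewrite !germ_res.
Qed.

Lemma germ_surj3 (a b c : stalk) :
  exists (U : opens X) (Ux : U x) (s t u : OX U),
    [/\ a = germ Ux s, b = germ Ux t & c = germ Ux u].
Proof.
have [U [Ux [s [t [-> ->]]]]] := germ_surj2 a b.
have [V [Vx [u ->]]] := germ_surj c; exists (opensI U V), (conj Ux Vx),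
  (res (@suboIl _ U V) s), (res (@suboIl _ U V) t), (res (@suboIr _ U V) u).
by rewrite !germ_res.
Qed.

Definition stalk_lift2 (op : forall U, OX U -> OX U -> @OX K X U) (a b : stalk) : stalk :=
  let U := pdom (repr a) in let V := pdom (repr b) in
  germ (conj (pdomP (repr a)) (pdomP (repr b)) : opensI U V x)
    (op _ (res (@suboIl _ U V) (pval (repr a))) (res (@suboIr _ U V) (pval (repr b)))).

Lemma stalk_lift2E (op : forall U, OX U -> OX U -> @OX K X U) :
  (forall U V (h : subo V U) s t, res h (op U s t) = op V (res h s) (res h t)) ->
  forall (U : opens X) (Ux : U x) (s t : OX U),
    stalk_lift2 op (germ Ux s) (germ Ux t) = germ Ux (op U s t).
Proof.
move=> opr U Ux s t; rewrite /stalk_lift2.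
set a := repr (germ Ux s); set b := repr (germ Ux t).
have : germ Ux s = germ (pdomP a) (pval a).
  by rewrite -[LHS]reprK -/a; case: (a).
have : germ Ux t = germ (pdomP b) (pval b).
  by rewrite -[LHS]reprK -/b; case: (b).
move: (pdomP a) (pdomP b) (pval a) (pval b); move: (pdom a) (pdom b) => A B.
move=> Ax Bx s' t' /germ_eqP [W [h [k [Wx e]]]] /germ_eqP [N [i [j [Nx f]]]].
pose c := @suboIl _ W N; pose d := @suboIr _ W N.
apply/germ_eqP.
have l : subo (opensI W N) (opensI A B) by move=> y [/k ? /j ?].
exists (opensI W N), l, (subo_trans c h); split=> //; rewrite !opr.
rewrite (res_comp _ l (subo_trans d j)) -(res_comp j d) -f.
rewrite (res_comp _ l (subo_trans c k)) -(res_comp k c) -e.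
by rewrite (res_comp h c (subo_trans c h)) (res_comp i d (subo_trans c h)).
Qed.

Definition stalk_add := stalk_lift2 (fun U s t => s + t).
Definition stalk_mul := stalk_lift2 (fun U s t => s * t).
Definition stalk_opp (a : stalk) : stalk :=
  germ (pdomP (repr a)) (- pval (repr a)).
Definition stalk0 : stalk := germ (I : opensT X x) 0.
Definition stalk1 : stalk := germ (I : opensT X x) 1.

Lemma germD_ (U : opens X) (Ux : U x) (s t : OX U) :
  stalk_add (germ Ux s) (germ Ux t) = germ Ux (s + t).
Proof. by apply: stalk_lift2E => *; rewrite rmorphD. Qed.

Lemma germM_ (U : opens X) (Ux : U x) (s t : OX U) :
  stalk_mul (germ Ux s) (germ Ux t) = germ Ux (s * t).
Proof. by apply: stalk_lift2E => *; rewrite rmorphM. Qed.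

Lemma germ0_ (U : opens X) (Ux : U x) : stalk0 = germ Ux 0.
Proof.
have h : subo U (opensT X) by move=> y.
by rewrite /stalk0 -(germ_res (I : opensT X x) Ux h) rmorph0.
Qed.

Lemma germ1_ (U : opens X) (Ux : U x) : stalk1 = germ Ux 1.
Proof.
have h : subo U (opensT X) by move=> y.
by rewrite /stalk1 -(germ_res (I : opensT X x) Ux h) rmorph1.
Qed.

Lemma germN_ (U : opens X) (Ux : U x) (s : OX U) : stalk_opp (germ Ux s) = germ Ux (- s).
Proof.
rewrite /stalk_opp; set a := repr (germ Ux s).
have : germ Ux s = germ (pdomP a) (pval a).
  by rewrite -[LHS]reprK -/a; case: (a).
move=> /germ_eqP [W [h [k [Wx e]]]]; apply/germ_eqP.
by exists W, k, h; rewrite !rmorphN e.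
Qed.

Lemma stalk_addA : associative stalk_add.
Proof.
by move=> a b c; have [U [Ux [s [t [u [-> -> ->]]]]]] := germ_surj3 a b c;
  rewrite !germD_ addrA.
Qed.

Lemma stalk_addC : commutative stalk_add.
Proof.
by move=> a b; have [U [Ux [s [t [-> ->]]]]] := germ_surj2 a b;
  rewrite !germD_ addrC.
Qed.

Lemma stalk_add0 : left_id stalk0 stalk_add.
Proof.
by move=> a; have [U [Ux [s ->]]] := germ_surj a; rewrite (germ0_ Ux) germD_ add0r.
Qed.

Lemma stalk_addN : left_inverse stalk0 stalk_opp stalk_add.
Proof.
by move=> a; have [U [Ux [s ->]]] := germ_surj a;
  rewrite germN_ germD_ addNr (germ0_ Ux).
Qed.

HB.instance Definition _ :=
  GRing.isZmodule.Build stalk stalk_addA stalk_addC stalk_add0 stalk_addN.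

Lemma stalk_mulA : associative stalk_mul.
Proof.
by move=> a b c; have [U [Ux [s [t [u [-> -> ->]]]]]] := germ_surj3 a b c;
  rewrite !germM_ mulrA.
Qed.

Lemma stalk_mulC : commutative stalk_mul.
Proof.
by move=> a b; have [U [Ux [s [t [-> ->]]]]] := germ_surj2 a b;
  rewrite !germM_ mulrC.
Qed.

Lemma stalk_mul1 : left_id stalk1 stalk_mul.
Proof.
by move=> a; have [U [Ux [s ->]]] := germ_surj a; rewrite (germ1_ Ux) germM_ mul1r.
Qed.

Lemma stalk_mulDl : left_distributive stalk_mul +%R.
Proof.
move=> a b c; have [U [Ux [s [t [u [-> -> ->]]]]]] := germ_surj3 a b c.
change (stalk_mul (stalk_add (germ Ux s) (germ Ux t)) (germ Ux u) =
  stalk_add (stalk_mul (germ Ux s) (germ Ux u)) (stalk_mul (germ Ux t) (germ Ux u))).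
by rewrite germD_ !germM_ germD_ mulrDl.
Qed.

HB.instance Definition _ :=
  GRing.Zmodule_isComPzRing.Build stalk stalk_mulA stalk_mulC stalk_mul1 stalk_mulDl.

Lemma germ_additive (U : opens X) (Ux : U x) : zmod_morphism (germ Ux).
Proof.
move=> s t; rewrite -germD_ -germN_.
by [].
Qed.

Lemma germ_multiplicative (U : opens X) (Ux : U x) : monoid_morphism (germ Ux).
Proof. by split=> [|s t]; rewrite -?germ1_ -?germM_. Qed.

HB.instance Definition _ (U : opens X) (Ux : U x) :=
  GRing.isZmodMorphism.Build (OX U) stalk (germ Ux) (@germ_additive U Ux).
HB.instance Definition _ (U : opens X) (Ux : U x) :=
  GRing.isMonoidMorphism.Build (OX U) stalk (germ Ux) (@germ_multiplicative U Ux).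

End Stalk.

(** * Commutative algebra *)

Section CommutativeAlgebra.
Context (A : comPzRingType).

Definition prime_ideal (p : set A) : Prop :=
  [/\ p 0, forall a b, p a -> p b -> p (a + b), forall a b, p b -> p (a * b),
      ~ p 1 & forall a b, p (a * b) -> p a \/ p b].

Definition invertible (a : A) : Prop := exists b, a * b = 1.

Definition prime_chain (d : nat) : Prop :=
  exists p : 'I_d.+1 -> set A, (forall i, prime_ideal (p i)) /\
    (forall i j : 'I_d.+1, (i < j)%N -> p i `<` p j).

Definition krull_dim (d : nat) : Prop := prime_chain d /\ ~ prime_chain d.+1.

Definition ideal_gen (d : nat) (s : 'I_d -> A) : set A :=
  [set a | exists c : 'I_d -> A, a = \sum_i c i * s i].

(* The next definitions are meant for a local ring, whose maximal ideal is the
   set of non-invertible elements. *)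
Definition regular_local (d : nat) : Prop :=
  krull_dim d /\
  exists s : 'I_d -> A, [set a | ~ invertible a] = ideal_gen s.

Definition regular_sequence (d : nat) (s : 'I_d -> A) : Prop :=
  (forall i, ~ invertible (s i)) /\
  forall (i : 'I_d) (a : A),
    (exists c : 'I_d -> A, s i * a = \sum_(j < d | (j < i)%N) c j * s j) ->
    exists c : 'I_d -> A, a = \sum_(j < d | (j < i)%N) c j * s j.

Definition depth (d : nat) : Prop :=
  (exists s : 'I_d -> A, regular_sequence s) /\
  forall e (s : 'I_e -> A), regular_sequence s -> (e <= d)%N.

Definition cohen_macaulay_local : Prop := exists d, krull_dim d /\ depth d.

End CommutativeAlgebra.

Definition is_localization (A B : comPzRingType) (a : A) (f : {rmorphism A -> B}) :
    Prop :=
  [/\ invertible (f a),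
      forall b, exists k c, b * f a ^+ k = f c &
      forall c, f c = 0 -> exists k, a ^+ k * c = 0].

Definition fin_gen_algebra (K A : comPzRingType) (c : {rmorphism K -> A}) : Prop :=
  exists d (s : 'I_d -> A), forall B : set A,
    (forall k, B (c k)) -> (forall i, B (s i)) ->
    (forall a b, B a -> B b -> B (a + b)) ->
    (forall a b, B a -> B b -> B (a * b)) ->
    forall a, B a.

(** * Schemes over K *)

Section Schemes.
Context (K : comPzRingType) (X : ringedSpace K).

(* The point of Spec O_X(U) attached to x in U. *)
Definition point_ideal (U : opens X) x (Ux : U x) : set (OX U) :=
  [set a | ~ invertible (germ Ux a)].

(* The canonical map U -> Spec O_X(U) is an isomorphism of ringed spaces: it is
   well defined and bijective, a homeomorphism, and the sections over each basic
   open set D(a) are the localization O_X(U)_a. *)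
Definition affine_open (U : opens X) : Prop :=
  [/\ forall x (Ux : U x), prime_ideal (point_ideal Ux),
      forall p : set (OX U), prime_ideal p ->
        exists x (Ux : U x), point_ideal Ux = p,
      forall x y (Ux : U x) (Uy : U y),
        point_ideal Ux = point_ideal Uy -> x = y,
      forall (V : opens X) x (Ux : U x), subo V U -> V x ->
        exists a : OX U, ~ point_ideal Ux a /\
          forall y (Uy : U y), ~ point_ideal Uy a -> V y &
      forall (a : OX U) V (h : subo V U),
        (forall y (Uy : U y), V y <-> ~ point_ideal Uy a) ->
        is_localization a (res h)].

Definition scheme_of_finite_type : Prop :=
  exists d (W : 'I_d -> opens X), (forall x, exists i, W i x) /\
    forall i, affine_open (W i) /\ fin_gen_algebra (cst (W i)).

Definition closed_point (x : X) : Prop := closed [set x].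

Definition cohen_macaulay : Prop := forall x : X, cohen_macaulay_local (stalk x).

(* Over an algebraically closed field, a scheme of finite type is smooth if and
   only if its local rings at closed points are regular. *)
Definition smooth_of_dim (d : nat) : Prop :=
  scheme_of_finite_type /\ forall x : X, closed_point x -> regular_local (stalk x) d.

Definition irreducible_space : Prop :=
  (exists x : X, True) /\
  forall U V : opens X, (exists x, U x) -> (exists x, V x) ->
    exists x, U x /\ V x.

Definition reduction : ringedSpace K := nilSubspace (nilradical X).

End Schemes.

Definition smooth_irreducible_curve (K : comPzRingType) (X : ringedSpace K) : Prop :=
  smooth_of_dim X 1 /\ irreducible_space X.

Definition smooth_surface (K : comPzRingType) (X : ringedSpace K) : Prop :=
  smooth_of_dim X 2.

Section Embeddings.
Context (K : comPzRingType) (X S : ringedSpace K).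

(* A K-morphism of locally ringed spaces from the open subspace U of X to S.
   The values of [mfun] outside U are irrelevant. *)
Record openMor (U : opens X) := OpenMor {
  mfun :> X -> S;
  mfun_continuous : forall W : opens S, open [set x | U x /\ W (mfun x)];
  pull : forall (W : opens S) (V : opens X),
    subo V U -> (forall x, V x -> W (mfun x)) -> {rmorphism OX W -> OX V};
  pull_cst : forall (W : opens S) (V : opens X) (h : subo V U) (k : forall x, V x -> W (mfun x)) c,
    pull h k (cst W c) = cst V c;
  pull_res : forall (W : opens S) (V : opens X) (h : subo V U) (k : forall x, V x -> W (mfun x))
      (W' : opens S) (V' : opens X) (h' : subo V' U) (k' : forall x, V' x -> W' (mfun x))
      (i : subo W' W) (j : subo V' V) (s : OX W),
    pull h' k' (res i s) = res j (pull h k s);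
  pull_local : forall (W : opens S) (V : opens X) (h : subo V U) (k : forall x, V x -> W (mfun x))
      x (Vx : V x) (s : OX W),
    invertible (germ Vx (pull h k s)) -> invertible (germ (k x Vx) s)
}.

Definition closed_embedding (U : opens X) (f : openMor U) : Prop :=
  [/\ forall x y, U x -> U y -> f x = f y -> x = y,
      forall V : opens X, subo V U ->
        exists W : opens S, forall x, U x -> (V x <-> W (f x)),
      closed [set y | exists2 x, U x & f x = y] &
      forall (V : opens X) (x : X) (s : OX V), subo V U -> V x ->
        exists (V' : opens X) (h : subo V' U) (W : opens S) (k : forall x, V' x -> W (f x))
               (i : subo V' V) (t : OX W), V' x /\ pull h k t = res i s].

(* The ideal, in the local ring O_{S,f(x)}, of the closed subspace of U defined
   by the ideal sheaf J, viewed as a closed subspace of S. *)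
Definition ideal_at (U : opens X) (f : openMor U) (J : idealSheaf X) (x : X) :
    set (stalk (f x)) :=
  [set a | exists (V : opens X) (h : subo V U) (W : opens S) (k : forall x, V x -> W (f x)) (Vx : V x)
             (t : OX W), a = germ (k x Vx) t /\ J V (pull h k t)].

End Embeddings.
Arguments ideal_at {K X S U} f J x.
Arguments nilradical {K} X.

Definition principal (A : comPzRingType) (z : A) : set A :=
  [set a | exists b, a = b * z].

(** * Primitive multiple curves and quasi locally free sheaves *)

(* The ideal sheaf of C_n in C_n itself is zero, so the last equality says that
   the ideal of C_n in O_{S,P} is (z^n). *)
Record primitive_multiple_curve (K : comPzRingType) (n : nat) (X : ringedSpace K) :
    Prop := PrimitiveMultipleCurve {
  pmc_scheme : scheme_of_finite_type X;
  pmc_cm : cohen_macaulay X;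
  pmc_curve : smooth_irreducible_curve (reduction X);
  pmc_local : forall P : X, closed_point P ->
    exists (U : opens X) (S : ringedSpace K) (f : openMor S U),
      [/\ U P, smooth_surface S, closed_embedding f &
        exists z : stalk (f P),
          ideal_at f (nilradical X) P = principal z /\
          ideal_at f (zeroMod (structMod X)) P = principal (z ^+ n)]
}.

Section Sheaves.
Context (K : comPzRingType) (X : ringedSpace K).

Definition generates (E : sheafMod X) (U : opens X) (d : nat) (s : 'I_d -> E U) :
    Prop :=
  forall V (h : subo V U) (t : E V) x, V x ->
    exists W (k : subo W V) (l : subo W U), W x /\
      exists a : 'I_d -> OX W, mres k t = \sum_i a i *: mres l (s i).

Definition relation_on (E : sheafMod X) (U : opens X) (d : nat) (s : 'I_d -> E U)
    V (h : subo V U) (a : 'I_d -> OX V) : Prop :=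
  \sum_i a i *: mres h (s i) = 0.

Definition coherent (E : sheafMod X) : Prop :=
  (forall x : X, exists (U : opens X) d (s : 'I_d -> E U), U x /\ generates s) /\
  (forall (U : opens X) d (s : 'I_d -> E U) x, U x ->
     exists V (h : subo V U) e (b : 'I_e -> 'I_d -> OX V),
       [/\ V x, forall k, relation_on s h (b k) &
         forall W (i : subo W V) (j : subo W U) (a : 'I_d -> OX W),
           relation_on s j a -> forall y, W y ->
           exists N (l : subo N W) (m : subo N V) (c : 'I_e -> OX N),
             N y /\ forall r, res l (a r) = \sum_k c k * res m (b k r)]).

(* The structure sheaf O_{C_i} of the closed subscheme of ideal I_C^i, as a sheaf
   of modules over O_{C_n}. *)
Definition structC (i : nat) : sheafMod X :=
  quotMod (idealPow (nilradical X) i).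

Definition quasi_locally_free (n : nat) (E : sheafMod X) : Prop :=
  coherent E /\
  exists m : 'I_n -> nat, forall x : X, exists U : opens X, U x /\
    isomorphic_on U E
      (dsumMod (fun ij : {i : 'I_n & 'I_(m i)} => structC (tag ij).+1)).

Definition vector_bundle (E : sheafMod X) : Prop :=
  forall x : X, exists (U : opens X) (r : nat),
    U x /\ isomorphic_on U E (freeMod X r).

(* E|_C = E (x) O_C, presented as E / I_C E and seen as a sheaf on C_n. *)
Definition restrictC (E : sheafMod X) : sheafMod X :=
  quotMod (idealMul (nilradical X) (fullMod E)).

Lemma mor_idealMul (J : idealSheaf X) (E F : sheafMod X) (f : modMor E F) U (s : E U) :
  idealMul J (fullMod E) U s -> idealMul J (fullMod F) U (f U s).
Proof.
move=> Js x /Js [V [h [Vx [n [a [g [Ja _ e]]]]]]]; exists V, h; split=> //.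
exists n, a, (fun i => f V (g i)); split=> //.
by rewrite -mor_res e linear_sum; apply: eq_bigr => i _; rewrite linearZ.
Qed.

Definition restrictC_mor (E F : sheafMod X) (f : modMor E F) :
    modMor (restrictC E) (restrictC F) :=
  quot_map (@mor_idealMul (nilradical X) E F f).

End Sheaves.

(* Main.v *)
From HB Require Import structures.
Require Import Defs.
From mathcomp Require Import all_boot all_order all_algebra.
From mathcomp Require Import boolp classical_sets functions cardinality topology.
From mathcomp Require Import reals complex.

Set Implicit Arguments.
Unset Strict Implicit.
Unset Printing Implicit Defensive.

Import GRing.Theory.
Local Open Scope classical_set_scope.
Local Open Scope ring_scope.

(* A system of minimal generators g_1, ..., g_m of E near a point (generators
   that are independent modulo the nilradical I) gives a surjection O^m -> E that
   is an isomorphism modulo I, and quasi local freeness provides such systems, with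
   m the same everywhere.  Two systems differ by a square matrix that is invertible
   modulo I, hence invertible.  On a curve, a nonempty open set has a finite
   complement of closed points, so the local surjections can be glued one point x
   at a time: if F -> E is already built on W and x is not in W, a neighbourhood V
   of x can be shrunk, by removing finitely many points other than x, until V :&: W
   lies in a given nonempty open set on which the generators of E chosen on V lift
   to a basis of F.  Gluing F|_W and O^m|_V along V :&: W involves no triple
   intersection, so there is no cocycle condition to satisfy. *)

(** * Determinants modulo an ideal *)

(** That nonempty open sets of the curve are cofinite has to be extracted from smoothness and finite
    type. Inside an affine chart the open set contains a basic open set D(a), and every point
    outside D(a) gives a prime containing a. Dimension one at closed points forces these points to
    be closed, so the primes above (a) are pairwise incomparable; a Noetherian ring has only
    finitely many of them, and this is what Hilbert's basis theorem is for. The gluing is shaped by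
    the fact that generators of E lift to bases of F only locally, so the new chart must meet the
    part already treated inside one small open set. Each intermediate F is a sheaf on all of X, with
    controlled behaviour only over the treated part: a glued section carries a component in E, and
    away from V and W the glued sheaf is just E. Hence the construction can start from F = E with
    nothing treated. *)

Section Congruence.
Context (A : comPzRingType) (J : set A).
Hypothesis (J0 : J 0) (JD : forall a b, J a -> J b -> J (a + b))
  (JM : forall a b, J b -> J (a * b)).

Lemma ideal_prod_congr (I : Type) (r : seq I) (f g : I -> A) :
  (forall i, J (f i - g i)) -> J (\prod_(i <- r) f i - \prod_(i <- r) g i).
Proof.
move=> fg; apply: (big_ind2 (fun a b => J (a - b))) => [|a b c d ab cd|//].
  by rewrite subrr.
have -> : a * c - b * d = c * (a - b) + b * (c - d).
  by rewrite !mulrBr (mulrC c) (mulrC c) subrKA.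
by apply: JD; apply: JM.
Qed.

Lemma ideal_sum (I : Type) (r : seq I) (P : pred I) (f : I -> A) :
  (forall i, J (f i)) -> J (\sum_(i <- r | P i) f i).
Proof. by move=> Jf; apply: big_ind. Qed.

Lemma ideal_det1 m (M : 'M[A]_m) :
  (forall i j, J (M i j - (i == j)%:R)) -> J (\det M - 1).
Proof.
move=> M1; rewrite -(det1 A m) /determinant -sumrB; apply: ideal_sum => s.
rewrite -mulrBr; apply: JM; apply: ideal_prod_congr => i.
by rewrite [1%:M _ _]mxE; apply: M1.
Qed.

End Congruence.

(** The inverse is the geometric series in the nilpotent element [1 - a]. *)
Lemma unipotent_unit (A : comPzRingType) (a : A) k :
  (a - 1) ^+ k = 0 -> exists b, a * b = 1.
Proof.
move=> ak; exists (\sum_(i < k) (1 - a) ^+ i).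
have e : (1 - a) ^+ k = 0 by rewrite -opprB exprNn ak mulr0.
have := subrX1 (1 - a) k.
by rewrite e sub0r addrAC subrr sub0r mulNr => /oppr_inj.
Qed.

(** * Hilbert's basis theorem and primes of Noetherian rings *)

Section Noetherian.
Context (A : comPzRingType).
Implicit Types (B J : set A).

(** Subrings are subsets of one fixed ring [A]: adjoining generators then produces a growing family
    of subsets, which ends with [setT] for a finitely generated algebra. *)
Definition subring B : Prop :=
  [/\ B 1, forall a b, B a -> B b -> B (a - b) &
      forall a b, B a -> B b -> B (a * b)].

Definition ideal_in B J : Prop :=
  [/\ J `<=` B, J 0, forall a b, J a -> J b -> J (a + b) &
      forall a b, B a -> J b -> J (a * b)].

(* Finite generation is phrased by the universal property of the ideal
   generated by the members of [l]. *)
Definition noetherian B : Prop := forall J, ideal_in B J ->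
  exists l : seq A, (forall a, a \in l -> J a) /\
    forall J', ideal_in B J' -> (forall a, a \in l -> J' a) -> J `<=` J'.

Lemma subring0 B : subring B -> B 0.
Proof. by case=> B1 Bb _; rewrite -(subrr 1); exact: (Bb _ _ B1 B1). Qed.

Lemma subringD B a b : subring B -> B a -> B b -> B (a + b).
Proof.
move=> Br Ba Bb; have [_ Bs _] := Br; rewrite -[b]opprK -[- b]sub0r.
by apply: (Bs) => //; apply: (Bs) => //; apply: subring0.
Qed.

Definition adjoin B (s : A) : set A :=
  [set a | exists n (c : nat -> A), (forall i, B (c i)) /\ a = \sum_(i < n) c i * s ^+ i].

Lemma adjoinS B s c a : B c -> adjoin B s a -> adjoin B s (c + s * a).
Proof.
move=> Bc [n [f [Bf ->]]]; exists n.+1, (fun i => if i is j.+1 then f j else c).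
split=> [[|i]//|]; rewrite big_ord_recl expr0 mulr1 big_distrr; congr (_ + _).
by apply: eq_bigr => i _; rewrite /= exprS mulrCA.
Qed.

Section Adjoin.
Context (B : set A) (s : A) (Br : subring B).

(** Horner's scheme: the elements of B[s] arise from 0 by steps [c + s * a]. Closure under
    differences and products then needs no manipulation of coefficients. *)
Lemma adjoin_ind (P : A -> Prop) : P 0 ->
  (forall c a, B c -> adjoin B s a -> P a -> P (c + s * a)) ->
  forall a, adjoin B s a -> P a.
Proof.
move=> P0 PS _ [n [c [Bc ->]]]; elim: n c Bc => [|n IH] c Bc.
  by rewrite big_ord0.
rewrite big_ord_recl expr0 mulr1.
have -> : \sum_(i < n) c (lift ord0 i) * s ^+ lift ord0 i =
    s * \sum_(i < n) (c \o S) i * s ^+ i.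
  by rewrite big_distrr; apply: eq_bigr => i _; rewrite /= exprS mulrCA.
apply: PS => //; last by apply: IH => i; apply: Bc.
by exists n, (c \o S); split=> // i; apply: Bc.
Qed.

Lemma adjoin0 : adjoin B s 0.
Proof.
by exists 0%N, (fun=> 0); split=> [i|]; rewrite ?big_ord0 //; apply: subring0.
Qed.

Lemma adjoin_sub : B `<=` adjoin B s.
Proof.
by move=> c Bc; rewrite -[c]addr0 -(mulr0 s); apply: adjoinS => //; apply: adjoin0.
Qed.

Lemma adjoinX a : adjoin B s a -> adjoin B s (s * a).
Proof. by move=> Ba; rewrite -[s * a]add0r; apply: adjoinS => //; apply: subring0. Qed.

Lemma adjoin_gen : adjoin B s s.
Proof. by have [B1 _ _] := Br; rewrite -{2}[s]mulr1; apply: adjoinX; apply: adjoin_sub. Qed.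

Lemma adjoinB a b : adjoin B s a -> adjoin B s b -> adjoin B s (a - b).
Proof.
have [_ Bs Bm] := Br; move=> Ba; move: a Ba b; apply: adjoin_ind => [|c a Bc Ba IH].
  apply: adjoin_ind => [|c b Bc _ IH]; first by rewrite subrr; apply: adjoin0.
  rewrite sub0r opprD -mulrN -sub0r; apply: adjoinS; last by rewrite -sub0r.
  by apply: (Bs) => //; apply: subring0.
move=> b; apply: (adjoin_ind (P := fun b => adjoin B s (c + s * a - b))).
  by rewrite subr0; apply: adjoinS.
move=> d b' Bd Bb' _; rewrite opprD addrACA -mulrBr.
by apply: adjoinS; [apply: Bs|apply: IH].
Qed.

Lemma adjoinD a b : adjoin B s a -> adjoin B s b -> adjoin B s (a + b).
Proof.
move=> Ba Bb; rewrite -[b]opprK -[- b]sub0r; apply: adjoinB => //.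
by apply: adjoinB => //; apply: adjoin0.
Qed.

Lemma adjoinM a b : adjoin B s a -> adjoin B s b -> adjoin B s (a * b).
Proof.
have [_ _ Bm] := Br; move=> Ba Bb; move: a Ba; apply: adjoin_ind => [|c a Bc Ba IH].
  by rewrite mul0r; apply: adjoin0.
rewrite mulrDl -mulrA; apply: adjoinD; last exact: adjoinX.
move: b Bb {IH}; apply: adjoin_ind => [|d b Bd Bb IH].
  by rewrite mulr0; apply: adjoin0.
by rewrite mulrDr mulrCA; apply: adjoinS => //; apply: Bm.
Qed.

Lemma adjoin_subring : subring (adjoin B s).
Proof.
split; [|exact: adjoinB|exact: adjoinM].
by apply: adjoin_sub; case: Br.
Qed.

Definition poly_value (c : nat -> A) n : A := \sum_(i < n) c i * s ^+ i.

(* A member of [J] may be the value at [s] of several polynomials over [B]; one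
   of them having leading coefficient [b] is enough. *)
Definition lead_ideal (J : set A) n : set A :=
  [set b | exists c : nat -> A, [/\ forall i, B (c i), c n = b & J (poly_value c n.+1)]].

Lemma lead_idealP J n : ideal_in (adjoin B s) J -> ideal_in B (lead_ideal J n).
Proof.
have [_ _ Bm] := Br; move=> [_ J0 JD JM]; split.
- by move=> _ [c [Bc <- _]].
- exists (fun=> 0); split=> [i|//|]; first exact: subring0.
  by rewrite /poly_value big1 // => i _; rewrite mul0r.
- move=> _ _ [c [Bc <- Jc]] [d [Bd <- Jd]]; exists (fun i => c i + d i); split=> //.
    by move=> i; apply: subringD.
  rewrite (_ : poly_value _ _ = poly_value c n.+1 + poly_value d n.+1); first exact: JD.
  by rewrite /poly_value -big_split; apply: eq_bigr => i _; rewrite mulrDl.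
- move=> a _ Ba [c [Bc <- Jc]]; exists (fun i => a * c i); split=> //.
    by move=> i; apply: Bm.
  rewrite (_ : poly_value _ _ = a * poly_value c n.+1).
    by apply: JM => //; apply: adjoin_sub.
  by rewrite /poly_value big_distrr; apply: eq_bigr => i _; rewrite /= mulrA.
Qed.

Lemma lead_idealS J n m : ideal_in (adjoin B s) J -> (n <= m)%N ->
  lead_ideal J n `<=` lead_ideal J m.
Proof.
move=> [_ _ _ JM] /subnK <-; elim: (m - n)%N => [//|k IH] b /IH [c [Bc <- Jc]].
exists (fun i => if i is j.+1 then c j else 0); split=> [[|i]//|//|].
  exact: subring0.
rewrite (_ : poly_value _ _ = s * poly_value c (k + n).+1).
  by apply: JM => //; apply: adjoin_gen.
rewrite /poly_value big_ord_recl mul0r add0r big_distrr.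
by apply: eq_bigr => i _; rewrite /= exprS mulrCA.
Qed.

(** The ideals of leading coefficients increase with the degree, and finite generation of their
    union makes them stop at some degree [N]. Polynomials realizing generators of the ideals of
    degree at most [N] generate [J]. *)
Theorem hilbert_basis : noetherian B -> noetherian (adjoin B s).
Proof.
have [_ Bs _] := Br; move=> Bn J Ji; pose L := lead_ideal J.
have Linf : ideal_in B [set b | exists n, L n b].
  split.
  - by move=> b [n]; case: (lead_idealP n Ji) => [+ _ _ _]; apply.
  - by exists 0%N; case: (lead_idealP 0 Ji).
  - move=> a b [n La] [m Lb]; exists (maxn n m).
    case: (lead_idealP (maxn n m) Ji) => _ _ + _; apply.
      by apply: lead_idealS La => //; apply: leq_maxl.
    by apply: lead_idealS Lb => //; apply: leq_maxr.
  - move=> a b Ba [n Lb]; exists n.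
    by case: (lead_idealP n Ji) => _ _ _; apply.
have [N LN] : exists N, [set b | exists n, L n b] `<=` L N.
  have [l [lL lgen]] := Bn _ Linf.
  suff [N lN] : exists N, forall a, a \in l -> L N a.
    by exists N; apply: lgen => //; apply: lead_idealP.
  elim: l lL {lgen} => [|a l IH] lL; first by exists 0%N.
  have [|N lN] := IH; first by move=> b bl; apply: lL; rewrite inE bl orbT.
  have [n Ln] := lL a (mem_head _ _); exists (maxn n N) => b.
  rewrite inE => /orP [/eqP ->|/lN]; first by apply: lead_idealS Ln => //; apply: leq_maxl.
  by apply: lead_idealS => //; apply: leq_maxr.
have /choice [l lP] n := Bn _ (lead_idealP n Ji).
have /choice [w wP] (nb : nat * A) : exists c : nat -> A, L nb.1 nb.2 ->
    [/\ forall i, B (c i), c nb.1 = nb.2 & J (poly_value c nb.1.+1)].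
  by have [[c H]|nL] := pselect (L nb.1 nb.2); [exists c|exists (fun=> 0)].
exists [seq poly_value (w (n, b)) n.+1 | n <- iota 0 N.+1, b <- l n]; split.
  move=> _ /allpairsPdep [n [b [_ bl ->]]].
  by have [|_ _] := wP (n, b); first exact: ((lP n).1 _ bl).
(* Leading coefficients are taken in the intersection with [J], so that subtracting a polynomial
   found in [J'] does not leave [J]. *)
move=> J' J'i lJ'; pose L' := lead_ideal (J `&` J').
have JJ'i : ideal_in (adjoin B s) (J `&` J').
  case: Ji J'i => [J1 J2 J3 J4] [J1' J2' J3' J4']; split=> [a []/J1//|//||].
    by move=> a b [? ?] [? ?]; split; [apply: J3|apply: J3'].
  by move=> a b Ba [? ?]; split; [apply: J4|apply: J4'].
have LL' n : L n `<=` L' n.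
  wlog nN : n / (n <= N)%N.
    move=> H; have [/H//|/ltnW Nn] := leqP n N.
    move=> b Lb; apply: lead_idealS Nn _ _ => //; apply: H => //.
    by apply: LN; exists n.
  apply: (lP n).2; first exact: lead_idealP.
  move=> b bl; have [|Bw wb Jw] := wP (n, b); first exact: ((lP n).1 _ bl).
  exists (w (n, b)); split=> //; split=> //; apply: lJ'; apply/allpairsPdep.
  by exists n, b; rewrite mem_iota.
(* Induction on the number of terms: the leading term is cancelled by some [d] whose value lies in
   both ideals. *)
have main n (c : nat -> A) : (forall i, B (c i)) -> J (poly_value c n) -> J' (poly_value c n).
  elim: n c => [|n IH] c Bc Jc; first by rewrite /poly_value big_ord0; case: J'i.
  have [|d [Bd dn [Jd J'd]]] := LL' n (c n); first by exists c.
  have e : poly_value c n.+1 = poly_value d n.+1 + poly_value (fun i => c i - d i) n.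
    rewrite /poly_value !big_ord_recr /= dn addrAC; congr (_ + _).
    by rewrite -big_split; apply: eq_bigr => i _; rewrite /= mulrBl addrC subrK.
  have Jm : J (poly_value (fun i => c i - d i) n).
    have -> : poly_value (fun i => c i - d i) n = poly_value c n.+1 + (-1) * poly_value d n.+1.
      by rewrite e mulN1r addrAC subrr add0r.
    case: Ji => _ _ JD JM; apply: JD => //; apply: JM => //.
    rewrite -sub0r; apply: adjoinB; first exact: adjoin0.
    by apply: adjoin_sub; case: Br.
  rewrite e; case: J'i => _ _ JD _; apply: JD => //; apply: IH => // i.
  exact: Bs.
by move=> a Ja; case: (Ji) => /(_ a Ja) [n [c [Bc e]]] _ _ _; rewrite e; apply: main; rewrite // /poly_value -e.
Qed.

End Adjoin.

Lemma noetherian_adjoin_seq (l : seq A) B : subring B -> noetherian B ->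
  exists B', [/\ subring B', noetherian B', B `<=` B' & forall a, a \in l -> B' a].
Proof.
elim: l B => [|s l IH] B Br Bn; first by exists B; split.
have [B' [B'r B'n BB' lB']] := IH _ (adjoin_subring s Br) (hilbert_basis Br Bn (s := s)).
exists B'; split=> //.
  by move=> a Ba; apply: BB'; apply: adjoin_sub.
by move=> a; rewrite inE => /orP [/eqP ->|/lB'//]; apply: BB'; apply: adjoin_gen.
Qed.

End Noetherian.

(** An ideal of the image is either zero or contains [f k] with [k] nonzero, and then [f k]
    generates it. The argument also covers the zero ring, where the image is not a field. *)
Lemma noetherian_field_image (K : fieldType) (A : comPzRingType) (f : {rmorphism K -> A}) :
  subring (range f) /\ noetherian (range f).
Proof.
split.
  split; first by exists 1; rewrite ?rmorph1.
    by move=> _ _ [a _ <-] [b _ <-]; exists (a - b); rewrite ?rmorphB.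
  by move=> _ _ [a _ <-] [b _ <-]; exists (a * b); rewrite ?rmorphM.
move=> J [JB J0 JD JM].
have [[k [k0 Jk]]|nJ] := pselect (exists k, k != 0 /\ J (f k)).
  exists [:: f k]; split=> [a|J' [_ _ _ J'M] kJ'].
    by rewrite inE => /eqP ->.
  move=> _ /JB [a _ <-]; rewrite -[a](mulfVK k0) rmorphM.
  by apply: J'M; [exists (a / k)|apply: kJ'; rewrite inE].
exists [::]; split=> // J' [_ J'0 _ _] _ a Ja; have [k _ e] := JB a Ja.
have [k0|k0] := eqVneq k 0; first by rewrite -e k0 rmorph0.
by case: nJ; exists k; rewrite e.
Qed.

Lemma fin_gen_noetherian (K : fieldType) (A : comPzRingType) (f : {rmorphism K -> A}) :
  fin_gen_algebra f -> noetherian (@setT A).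
Proof.
have [Br Bn] := noetherian_field_image f.
move=> [d [s sA]]; have [B [B'r B'n BB' sB]] := noetherian_adjoin_seq [seq s i | i : 'I_d] Br Bn.
suff <- : B = setT by [].
apply/seteqP; split=> // a _; case: (B'r) => _ _ Bm; apply: sA => //.
- by move=> k; apply: BB'; exists k.
- by move=> i; apply: sB; apply: map_f; rewrite mem_enum.
- by move=> x y; apply: subringD.
Qed.

Lemma Zorn_nonempty_chains (T : Type) (P : set (set T)) (A0 : set T) :
  P A0 -> (forall A, P A -> A !=set0) ->
  (forall F : set (set T), F `<=` P -> F !=set0 -> total_on F subset ->
    P (\bigcup_(A in F) A)) ->
  exists M, P M /\ forall B, P B -> M `<=` B -> B = M.
Proof.
move=> P0 Pn0 PF; pose Q A := A = set0 \/ P A.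
have [|M [QM maxM]] := @Zorn_bigcup T Q.
  move=> F FQ Ft; pose G := F `\ set0.
  have -> : \bigcup_(A in F) A = \bigcup_(A in G) A.
    apply/seteqP; split=> [x [A FA Ax]|x [A [FA _] Ax]]; exists A => //.
    by split=> // A0'; rewrite A0' in Ax.
  have [G0|Gn0] := eqVneq G set0; first by left; rewrite G0 bigcup_set0.
  right; apply: PF; last by move=> A B [FA _] [FB _]; apply: Ft.
    by move=> A [/FQ [A0' /(_ A0')|//]].
  exact/set0P.
have PM : P M.
  case: QM => // M0; exfalso; apply: (maxM A0); last by right.
  rewrite M0; split=> // A00; have [x] := Pn0 _ P0; exact: A00.
exists M; split=> // B PB MB; apply/seteqP; split=> //.
by apply: contrapT => nBM; apply: (maxM B); [split|right].
Qed.

Section Primes.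
Context (A : comPzRingType).
Implicit Types (p q J : set A).

Lemma prime_ideal_le_maximal p : prime_ideal p ->
  exists q, [/\ prime_ideal q, p `<=` q &
    forall q', prime_ideal q' -> q `<=` q' -> q' = q].
Proof.
move=> pp.
have [|q [[q0 _ _ _ _] _]|F Fp [q0 Fq0] Ft|q [[qp pq] qmax]] :=
    @Zorn_nonempty_chains A (fun q => prime_ideal q /\ p `<=` q) p.
- by split.
- by exists 0.
- split; last by move=> a pa; exists q0 => //; apply: (Fp _ Fq0).2.
  split.
  + by exists q0 => //; case: (Fp _ Fq0) => [[]].
  + move=> a b [q Fq qa] [r Fr rb].
    have [qr|rq] := Ft q r Fq Fr; [exists r => //|exists q => //].
      by case: (Fp _ Fr) => [[_ + _ _ _] _]; apply=> //; apply: qr.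
    by case: (Fp _ Fq) => [[_ + _ _ _] _]; apply=> //; apply: rq.
  + move=> a b [q Fq qb]; exists q => //.
    by case: (Fp _ Fq) => [[_ _ + _ _] _]; apply.
  + by move=> [q Fq q1]; case: (Fp _ Fq) => [[_ _ _ + _] _]; apply.
  + move=> a b [q Fq qab]; case: (Fp _ Fq) => [[_ _ _ _ /(_ a b qab) [qa|qb]] _].
      by left; exists q.
    by right; exists q.
by exists q; split=> // q' q'p qq'; apply: qmax => //; split=> // a /pq /qq'.
Qed.

(** Finitely many generators of the union already lie in one member of the chain. This is the chain
    condition that Zorn's lemma asks for in Noetherian induction. *)
Lemma noetherian_chain_union (F : set (set A)) : noetherian (@setT A) ->
  (forall J, F J -> ideal_in setT J) -> F !=set0 -> total_on F subset ->
  ideal_in setT (\bigcup_(J in F) J) /\ F (\bigcup_(J in F) J).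
Proof.
move=> An Fi [J0 FJ0] Ft.
have Ui : ideal_in setT (\bigcup_(J in F) J).
  split=> //.
  - by exists J0 => //; case: (Fi _ FJ0).
  - move=> a b [J FJ Ja] [H FH Hb].
    have [JH|HJ] := Ft J H FJ FH; [exists H => //|exists J => //].
      by case: (Fi _ FH) => [_ _ + _]; apply=> //; apply: JH.
    by case: (Fi _ FJ) => [_ _ + _]; apply=> //; apply: HJ.
  - move=> a b _ [J FJ Jb]; exists J => //.
    by case: (Fi _ FJ) => _ _ _; apply.
split=> //; have [l [lU lgen]] := An _ Ui.
suff [J [FJ lJ]] : exists J, F J /\ forall a, a \in l -> J a.
  suff -> : \bigcup_(J in F) J = J by [].
  apply/seteqP; split; last by move=> a Ja; exists J.
  by apply: lgen => //; apply: Fi.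
elim: l lU {lgen} => [|a l IH] lU; first by exists J0.
have [|J [FJ lJ]] := IH; first by move=> b bl; apply: lU; rewrite inE bl orbT.
have [H FH Ha] := lU a (mem_head _ _).
have [JH|HJ] := Ft J H FJ FH; [exists H|exists J]; split=> // b;
  rewrite inE => /orP [/eqP -> //|/lJ //]; [exact: JH|exact: HJ].
Qed.

Lemma ideal_add_principal J a : ideal_in setT J ->
  ideal_in setT [set b | exists c d, J c /\ b = c + d * a].
Proof.
move=> [_ J0 JD JM]; split=> //.
- by exists 0, 0; rewrite mul0r addr0.
- move=> _ _ [c [d [Jc ->]]] [c' [d' [Jc' ->]]]; exists (c + c'), (d + d').
  by split; [apply: JD|rewrite mulrDl addrACA].
- move=> e _ _ [c [d [Jc ->]]]; exists (e * c), (e * d).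
  by split; [apply: JM|rewrite mulrDr mulrA].
Qed.

(* Noetherian induction: an ideal maximal among those with infinitely many
   primes above them would be prime. *)
Lemma finite_primes_above J : noetherian (@setT A) -> ideal_in setT J ->
  (forall p q, prime_ideal p -> prime_ideal q -> J `<=` p -> p `<=` q -> p = q) ->
  finite_set [set p | prime_ideal p /\ J `<=` p].
Proof.
move=> An Ji max; apply: contrapT => Jinf.
pose bad H := [/\ ideal_in setT H, J `<=` H &
  ~ finite_set [set p | prime_ideal p /\ H `<=` p]].
have [||F Fb F0 Ft|M [[Mi JM Minf] Mmax]] := @Zorn_nonempty_chains A bad J.
- by split.
- by move=> H [[_ H0 _ _] _ _]; exists 0.
- by apply: (Fb); apply: (noetherian_chain_union An _ F0 Ft).2 => H /Fb [].
have step a : ~ M a -> finite_set [set p | prime_ideal p /\ M `<=` p /\ p a].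
  move=> nMa; pose H := [set b | exists c d, M c /\ b = c + d * a].
  have MH : M `<=` H by move=> b Mb; exists b, 0; rewrite mul0r addr0.
  have Hi : ideal_in setT H by apply: ideal_add_principal.
  have Ha : H a by exists 0, 1; rewrite add0r mul1r; split=> //; case: Mi.
  have : finite_set [set p | prime_ideal p /\ H `<=` p].
    apply: contrapT => Hinf; apply: nMa; rewrite -(Mmax H) //.
    by split=> // b /JM /MH.
  apply: sub_finite_set => p [pp [Mp pa]]; split=> // _ [c [d [/Mp pc ->]]].
  by case: pp => [_ pD pM _ _]; apply: pD => //; apply: pM.
have [M1|M1] := pselect (M 1).
  apply: Minf; rewrite (_ : [set p | _] = set0) //.
  by rewrite -subset0 => p [[_ _ _ p1 _] Mp]; apply: p1; apply: Mp.
(* If [M] is prime, incomparability leaves it as the only prime above itself. Otherwise some product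
   [a * b] lies in [M] with neither factor in [M], and [step] applies to both factors. *)
have [Mp|nMp] := pselect (forall a b, M (a * b) -> M a \/ M b).
  apply: Minf; apply: (@sub_finite_set _ _ [set M]) => // p [pp Mlp].
  apply: esym; apply: max => //; case: Mi => _ M0 MD MM; split=> //.
  by move=> a b; apply: MM.
apply: nMp => a b Mab; apply: contrapT => /not_orP [/step fa /step fb].
apply: Minf; apply: sub_finite_set (_ : finite_set (_ `|` _)); last first.
  by rewrite finite_setU; split; [exact: fa|exact: fb].
move=> p [pp Mp]; have [_ _ _ _ /(_ a b (Mp _ Mab)) [pa|pb]] := pp.
  by left; split.
by right; split.
Qed.

End Primes.

(** * Prime ideals in the localization at a prime *)

Definition is_localization_at (A B : comPzRingType) (m : set A) (f : {rmorphism A -> B}) :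
    Prop :=
  [/\ forall u, ~ m u -> invertible (f u),
      forall b, exists u c, ~ m u /\ b * f u = f c &
      forall c, f c = 0 -> exists u, ~ m u /\ u * c = 0].

Section LocalizationAt.
Context (A B : comPzRingType) (m : set A) (f : {rmorphism A -> B}).
Hypothesis (mp : prime_ideal m) (fl : is_localization_at m f).

Definition prime_ext (p : set A) : set B :=
  [set b | exists u c, [/\ ~ m u, p c & b * f u = f c]].

Let mM u v : ~ m u -> ~ m v -> ~ m (u * v).
Proof. by case: mp => _ _ _ _ mprime mu mv /mprime []. Qed.

Lemma prime_ext_contract p c : prime_ideal p -> p `<=` m ->
  prime_ext p (f c) <-> p c.
Proof.
have [_ _ inj] := fl; have [m0 _ _ m1 _] := mp; move=> [p0 _ pM _ pprime] pm; split.
  move=> [u [d [mu pd e]]]; have [|v [mv ev]] := inj (c * u - d).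
    by rewrite rmorphB rmorphM e subrr.
  have : p (v * u * c).
    rewrite -mulrA (mulrC u) -[c * u](subrK d) mulrDr ev add0r; exact: pM.
  by case/pprime => // /pm /(mM mv mu).
by move=> pc; exists 1, c; rewrite rmorph1 mulr1.
Qed.

Lemma prime_ext_prime p : prime_ideal p -> p `<=` m -> prime_ideal (prime_ext p).
Proof.
move=> pp pm; have [_ sur inj] := fl; have [m0 _ _ m1 _] := mp.
have [p0 pD pM p1 pprime] := pp; split.
- by rewrite -(rmorph0 f); apply/prime_ext_contract.
- move=> a b [u [c [mu pc ea]]] [v [d [mv pd eb]]].
  exists (u * v), (v * c + u * d); split; first exact: mM.
    by apply: pD; apply: pM.
  rewrite rmorphD !rmorphM -ea -eb mulrDl; congr (_ + _); last exact: mulrCA.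
  by rewrite mulrA mulrC.
- move=> a b [u [c [mu pc eb]]]; have [v [d [mv ea]]] := sur a.
  exists (v * u), (d * c); split; [exact: mM|exact: pM|].
  by rewrite !rmorphM -ea -eb mulrACA.
- by rewrite -(rmorph1 f) => /(prime_ext_contract 1 pp pm).
- move=> a b [u [c [mu pc e]]].
  have [v [d [mv ea]]] := sur a; have [w [d' [mw eb]]] := sur b.
  have [|t [mt et]] := inj (d * d' * u - v * w * c).
    by rewrite rmorphB !rmorphM -ea -eb -e (mulrACA a) (mulrAC (a * b)) [X in X - _]mulrC subrr.
  have : p (t * u * (d * d')).
    rewrite -mulrA [u * _]mulrC -[d * d' * u](subrK (v * w * c)) mulrDr et add0r.
    by apply: (pM); apply: (pM).
  case/pprime => [/pm /(mM mt mu)//|/pprime [pd|pd']].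
    by left; exists v, d.
  by right; exists w, d'.
Qed.

(** Extension of primes below [m] is undone by contraction, so strict inclusions survive. The Krull
    dimension of a stalk thus bounds the chains of primes in an affine chart. *)
Lemma localization_prime_chain (d : nat) (p : 'I_d.+1 -> set A) :
  (forall i, prime_ideal (p i)) -> (forall i, p i `<=` m) ->
  (forall i j : 'I_d.+1, (i < j)%N -> p i `<` p j) -> prime_chain B d.
Proof.
move=> pp pm plt; exists (fun i => prime_ext (p i)); split.
  by move=> i; apply: prime_ext_prime.
move=> i j /plt [ij nji]; split.
  by move=> b [u [c [mu pc e]]]; exists u, c; split=> //; apply: ij.
move=> ji; apply: nji => c /(prime_ext_contract c (pp j) (pm j)) /ji.
by move=> /(prime_ext_contract c (pp i) (pm i)).
Qed.

End LocalizationAt.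

(** * Topology of curves *)

Lemma open_of_local (T : topologicalType) (P : set T) :
  (forall x, P x -> exists V : opens T, V x /\ (V : set T) `<=` P) -> open P.
Proof.
move=> H; rewrite openE => x /H [V [Vx VP]]; apply: filterS VP _.
by apply: open_nbhs_nbhs; split=> //; apply: opens_open.
Qed.

Lemma closed_finite_set (T : topologicalType) (S : set T) :
  finite_set S -> (forall x, S x -> closed [set x]) -> closed S.
Proof.
move=> /finite_seqP [s ->]; elim: s => [|x s IH] H.
  by rewrite (_ : [set` _] = set0) ?set_nil //; apply: closed0.
have -> : [set` x :: s] = [set x] `|` [set` s].
  apply/seteqP; split=> y /=; rewrite inE; first by case/orP => [/eqP|]; auto.
  by case=> [->|->]; rewrite ?eqxx ?orbT.
apply: closedU; first by apply: H; rewrite /= mem_head.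
by apply: IH => y ys; apply: H; rewrite /= inE ys orbT.
Qed.

Lemma closure1P (T : topologicalType) (x y : T) :
  closure [set x] y <-> forall V : opens T, V y -> V x.
Proof.
split=> [xy V Vy|H B].
  have [z [-> //]] : [set x] `&` V !=set0.
  by apply: xy; apply: open_nbhs_nbhs; split=> //; apply: opens_open.
rewrite nbhsE => -[V [Vo Vy] VB]; exists x; split=> //.
by apply: VB; apply: (H (Opens Vo)).
Qed.

(** * Points, primes and stalks of affine open sets *)

Section AffineOpens.
Context (K : comPzRingType) (X : ringedSpace K).
Implicit Types U V W : opens X.

(** An inverse of the germ of [a] at x, together with the relation expressing that it is an inverse,
    extends to a neighbourhood of x. Affineness of [U] is not assumed. *)
Lemma basic_open_proof U (a : OX U) :
  open [set y | exists Uy : U y, ~ point_ideal Uy a].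
Proof.
apply: open_of_local => x [Ux /contrapT [b ab]].
have [V [Vx [t bt]]] := germ_surj b; move: ab; rewrite {b}bt.
rewrite -(germ_res Ux (conj Ux Vx : opensI U V x) (@suboIl _ U V)).
rewrite -(germ_res Vx (conj Ux Vx : opensI U V x) (@suboIr _ U V)) -rmorphM.
rewrite -(rmorph1 (germ (conj Ux Vx : opensI U V x))) => /germ_eqP [W [h [k [Wx e]]]].
exists W; split=> // y Wy; have [Uy Vy] := h y Wy; exists Uy; apply.
exists (germ Vy t); rewrite -(germ_res Uy Wy (subo_trans h (@suboIl _ U V))).
rewrite -(germ_res Vy Wy (subo_trans h (@suboIr _ U V))) -rmorphM.
move: e; rewrite rmorph1 rmorphM (res_comp _ h (subo_trans h (@suboIl _ U V))).
rewrite (res_comp _ h (subo_trans h (@suboIr _ U V))) => ->.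
exact: rmorph1.
Qed.

Definition basic_open U (a : OX U) : opens X := Opens (@basic_open_proof U a).

Lemma basic_openP U (a : OX U) y (Uy : U y) : basic_open a y <-> ~ point_ideal Uy a.
Proof.
by split=> [[Uy']|]; [rewrite (Prop_irrelevance Uy' Uy)|exists Uy].
Qed.

Lemma basic_open_sub U (a : OX U) : subo (basic_open a) U.
Proof. by move=> x []. Qed.

Lemma basic_open_nbhs U V x (Ux : U x) : affine_open U -> V x ->
  exists a : OX U, ~ point_ideal Ux a /\ subo (basic_open a) V.
Proof.
move=> [_ _ _ bas _] Vx.
have [a [xa aV]] := bas (opensI U V) x Ux (@suboIl _ U V) (conj Ux Vx).
by exists a; split=> // y [Uy /aV []].
Qed.

Lemma point_ideal_specialize U x y (Ux : U x) (Uy : U y) : affine_open U ->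
  (point_ideal Ux `<=` point_ideal Uy <-> closure [set x] y).
Proof.
move=> Ua; rewrite closure1P; split=> [xy V Vy|xy a xa].
  have [a [ya aV]] := basic_open_nbhs Uy Ua Vy.
  by apply: aV; apply/basic_openP => /xy.
by apply: contrapT => /basic_openP /xy /(basic_openP a Ux).
Qed.

(** The sets D(a) with [a] outside the prime of x are cofinal among the neighbourhoods of x, and the
    sections over D(a) are fractions with powers of [a] as denominators. *)
Lemma germ_localization U x (Ux : U x) : affine_open U ->
  is_localization_at (point_ideal Ux) (germ Ux).
Proof.
move=> Ua; have [pp _ _ _ loc] := Ua; have [p0 _ _ p1 pprime] := pp x Ux.
have pX (a : OX U) k : ~ point_ideal Ux a -> ~ point_ideal Ux (a ^+ k).
  by move=> pa; elim: k => [|k IH]; rewrite ?expr0 // exprS => /pprime [].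
have aloc (a : OX U) : is_localization a (res (@basic_open_sub U a)).
  by apply: loc => y Uy; apply: basic_openP.
split=> [u /contrapT //|b|c].
  have [V [Vx [s ->]]] := germ_surj b.
  have [a [xa aV]] := basic_open_nbhs Ux Ua Vx; have ax := (basic_openP a Ux).2 xa.
  have [_ /(_ (res aV s)) [k [c e]] _] := aloc a.
  exists (a ^+ k), c; split; first exact: pX.
  rewrite /=.
  rewrite -(germ_res Vx ax aV) -(germ_res Ux ax (@basic_open_sub U a)) -rmorphM.
  by rewrite rmorphXn e; apply: germ_res.
rewrite -(rmorph0 (germ Ux)) => /germ_eqP [V [h [k [Vx]]]]; rewrite rmorph0 => e.
have [a [xa aV]] := basic_open_nbhs Ux Ua Vx; have [_ _ inj] := aloc a.
have [|m am] := inj c; last by exists (a ^+ m); split=> //; apply: pX.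
by rewrite -(res_comp h aV) e rmorph0.
Qed.

(** Induction on the number of charts that meet [Z]. A maximal prime above a point of [Z] gives a
    point x of [Z] closed in the chart [W i]. If x is not closed in the whole space, its closure
    minus [W i] is a nonempty closed subset of [Z] meeting fewer charts. *)
Lemma closed_point_exists d (W : 'I_d -> opens X) (Z : set X) :
  (forall x, exists i, W i x) -> (forall i, affine_open (W i)) ->
  closed Z -> Z !=set0 -> exists x, Z x /\ closed_point x.
Proof.
move=> cov aff; pose meets (Z : set X) := [set i | `[< exists x, Z x /\ W i x >]]%SET.
have [k] := ubnP #|meets Z|; elim: k Z => // k IH Z; rewrite ltnS => Zk Zc [z Zz].
have [i Wz] := cov z; have [pp surj inj _ _] := aff i.
have [q [qp zq qmax]] := prime_ideal_le_maximal (pp z Wz).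
have [x [Wx e]] := surj q qp; rewrite -{q}e in qp zq qmax.
have Zx : Z x.
  apply: contrapT => nZx.
  have [a [xa aZ]] := basic_open_nbhs (V := Opens (closed_openC Zc)) Wx (aff i) nZx.
  by apply: (aZ z) => //; apply/basic_openP => /zq.
have clZ : closure [set x] `<=` Z.
  by rewrite [X in _ `<=` X](closure_id Z).1 //; apply: closureS => _ ->.
have [E|nE] := pselect (closure [set x] `<=` W i).
  exists x; split=> //; rewrite /closed_point.
  suff -> : [set x] = closure [set x] by apply: closed_closure.
  apply/seteqP; split; first exact: subset_closure.
  move=> y xy; have Wy := E y xy; apply: (inj _ _ Wy Wx); apply: qmax => //.
  exact/point_ideal_specialize.
have [y [xy nWy]] : exists y, closure [set x] y /\ ~ W i y.
  by apply: contrapT => H; apply: nE => y xy; apply: contrapT => ?; apply: H; exists y.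
have [|||u [[xu _] uc]] := IH (closure [set x] `&` ~` (W i : set X)).
- apply: leq_trans Zk; apply: proper_card; apply/properP; split.
    apply/fintype.subsetP => j; rewrite !inE => -[u [[/clZ Zu _] Wu]].
    by exists u.
  exists i; first by rewrite !inE; exists z.
  by apply/negP; rewrite !inE => -[u [[_ ?] ?]].
- apply: closedI; first exact: closed_closure.
  by apply: open_closedC; apply: opens_open.
- by exists y.
by exists u; split=> //; apply: clZ.
Qed.

(** An element outside some prime has a nonempty basic open set. Two such sets meet, and at a common
    point neither element belongs to the prime of that point, so neither does their product. *)
Lemma irreducible_generic_prime U x (Ux : U x) : irreducible_space X -> affine_open U ->
  prime_ideal [set c : OX U | forall p, prime_ideal p -> p c].
Proof.
move=> [_ irr] [pp surj _ _ _]; split.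
- by move=> p [].
- by move=> a b pa pb p pr; case: (pr) => [_ + _ _ _]; apply; [apply: pa|apply: pb].
- by move=> a b pb p pr; case: (pr) => [_ _ + _ _]; apply; apply: pb.
- by move=> /(_ _ (pp x Ux)); case: (pp x Ux).
move=> a b ab; apply: contrapT => /not_orP [/existsNP [p /not_implyP [pr pa]]].
move=> /existsNP [q /not_implyP [qr qb]].
have [y [Uy ey]] := surj p pr; have [z [Uz ez]] := surj q qr.
have [||w [[Uw wa] /(basic_openP b Uw) wb]] := irr (basic_open a) (basic_open b).
- by exists y, Uy; rewrite ey.
- by exists z, Uz; rewrite ez.
by have [_ _ _ _ /(_ a b (ab _ (pp w Uw))) []] := pp w Uw.
Qed.

End AffineOpens.

(** * Cofiniteness of the nonempty open sets of a curve *)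

Section CurveTopology.
Context (K : fieldType) (Y : ringedSpace K).
Hypothesis Yc : smooth_irreducible_curve Y.

(** If z were not closed, its closure would contain a closed point y different from z. The generic
    prime, the prime of z and the prime of y would then form a chain of length two in the stalk at
    y, which has dimension one. *)
Lemma nongeneric_point_closed (O : opens Y) w z : O w -> ~ O z -> closed_point z.
Proof.
move: Yc => [[[d [W [cov aff]]] reg] irr] Ow nOz.
have [||y [zy yc]] := closed_point_exists (Z := closure [set z]) cov (fun i => (aff i).1).
- exact: closed_closure.
- by exists z; apply: subset_closure.
have [<- //|yz] := pselect (y = z); exfalso.
have [i Wy] := cov y; have Wa := (aff i).1; have [pp _ inj _ _] := Wa.
have Wz : W i z by move: zy => /closure1P; apply.
have [[_ nch] _] := reg y yc; apply: nch.
have p0 := irreducible_generic_prime Wy irr Wa.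
pose p (k : 'I_3) : set (OX (W i)) := if val k is 0%N then [set c | forall p, prime_ideal p -> p c]
  else if val k is 1%N then point_ideal Wz else point_ideal Wy.
have zy' : point_ideal Wz `<=` point_ideal Wy by apply/point_ideal_specialize.
(* Strictness comes from [O]: some nonempty D(a) lies in [O], so [a] vanishes at z without lying in
   every prime. *)
have p0z : [set c : OX (W i) | forall p, prime_ideal p -> p c] `<` point_ideal Wz.
  split; first by move=> c; apply; apply: pp.
  have [||v [Ov Wv]] := irr.2 O (W i); [by exists w|by exists y|].
  have [a [va aO]] := basic_open_nbhs Wv Wa Ov.
  move=> /(_ a) H; apply: va; apply: H; last exact: pp.
  by apply: contrapT => /basic_openP /aO.
have pzy : point_ideal Wz `<` point_ideal Wy.
  by split=> // yz'; apply: yz; apply: inj (Wy) (Wz) _; apply/seteqP.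
apply: (@localization_prime_chain _ _ _ (germ Wy) (pp y Wy) (germ_localization Wy Wa) 2 p).
- by move=> [[|[|k]] ?]; rewrite /p /=; [exact: p0|exact: pp|exact: pp].
- move=> [[|[|k]] ?]; rewrite /p /= //.
  by apply: subset_trans zy'; case: p0z.
- move=> [[|[|[|k]]] ?] [[|[|[|l]]] ?] //= _; rewrite /p //=.
  case: p0z pzy => sub nsub [sub' _]; split; first exact: subset_trans sub'.
  by move=> /(subset_trans sub').
Qed.

(** In each nonempty chart [O] contains a nonempty D(a). The points outside D(a) are closed, so the
    primes above (a) are pairwise incomparable, and [finite_primes_above] applies. *)
Lemma finite_complement (O : opens Y) w : O w -> finite_set (~` (O : set Y)).
Proof.
move: (Yc) => [[[d [W [cov aff]]] _] irr] Ow.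
suff H i : finite_set ((W i : set Y) `&` ~` (O : set Y)).
  apply: (@sub_finite_set _ _ (\bigcup_(i in @setT 'I_d) ((W i : set Y) `&` ~` (O : set Y)))).
    by move=> x nOx; have [i Wx] := cov x; exists i.
  by apply: bigcup_finite => //; apply: finite_finset.
have [[x Wx]|nW] := pselect (exists x, W i x); last first.
  apply: (@sub_finite_set _ _ set0) => // x [Wx _]; apply: nW; by exists x.
have [Wa Wf] := aff i; have [pp surj inj _ _] := Wa.
have [||v [Ov Wv]] := irr.2 O (W i); [by exists w|by exists x|].
have [a [va aO]] := basic_open_nbhs Wv Wa Ov.
pose J : set (OX (W i)) := principal a.
have Ji : ideal_in setT J.
  split=> //; first by exists 0; rewrite mul0r.
    by move=> _ _ [b ->] [c ->]; exists (b + c); rewrite mulrDl.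
  by move=> b _ _ [c ->]; exists (b * c); rewrite mulrA.
have Ja p : prime_ideal p -> J `<=` p <-> p a.
  move=> [_ _ pM _ _]; split=> [|pa _ [b ->]]; last exact: pM.
  by apply; exists 1; rewrite mul1r.
have fin : finite_set [set p | prime_ideal p /\ J `<=` p].
  apply: finite_primes_above (fin_gen_noetherian Wf) Ji _ => p q pr qr.
  have [y [Wy <-]] := surj p pr; have [z [Wz <-]] := surj q qr.
  move=> /(Ja _ (pp _ _)) ya /(point_ideal_specialize Wy Wz Wa).
  have yc : closed_point y.
    apply: (@nongeneric_point_closed (basic_open a) v); first by apply/basic_openP.
    by move=> /(basic_openP a Wy).
  rewrite -(closure_id [set y]).1 // => zy.
  by move: Wz; rewrite zy => Wz; rewrite (Prop_irrelevance Wy Wz).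
have /choice [g gP] (p : set (OX (W i))) : exists y, prime_ideal p ->
    exists Wy : W i y, point_ideal Wy = p.
  have [pr|npr] := pselect (prime_ideal p); last by exists x.
  by have [y [Wy e]] := surj p pr; exists y => _; exists Wy.
apply: sub_finite_set (finite_image g fin) => y [Wy nOy].
exists (point_ideal Wy); last first.
  by have [Wy' e] := gP _ (pp y Wy); apply: inj e.
split; first exact: pp.
by apply/Ja; [exact: pp|apply: contrapT => /basic_openP /aO].
Qed.

(** The union of [O] and the single point x is itself open, since its complement is a finite set of
    closed points. *)
Lemma open_adding_point (O : opens Y) w x : O w ->
  exists V : opens Y, V x /\ forall y, V y -> O y \/ y = x.
Proof.
move=> Ow; have cl : closed (~` (O : set Y) `\ x).
  apply: closed_finite_set; first exact: finite_setD (finite_complement Ow).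
  by move=> y [nOy _]; apply: nongeneric_point_closed Ow nOy.
exists (Opens (closed_openC cl)); split=> [[_]|y /= nOy]; first exact.
by apply: contrapT => /not_orP [? ?]; apply: nOy.
Qed.

End CurveTopology.

(** * Bases and minimal generators of sheaves of modules *)

Lemma common_nbhd (T : topologicalType) (I : finType) (U : opens T) x
    (P : I -> opens T -> Prop) : U x ->
  (forall i V W, subo W V -> P i V -> P i W) ->
  (forall i, exists V : opens T, V x /\ P i V) ->
  exists V : opens T, [/\ V x, subo V U & forall i, P i V].
Proof.
move=> Ux mono loc.
suff [V [Vx VU PV]] : exists V : opens T,
    [/\ V x, subo V U & forall i, i \in enum I -> P i V].
  by exists V; split=> // i; apply: PV; rewrite mem_enum.
elim: (enum I) => [|i l [V [Vx VU PV]]]; first by exists U; split.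
have [W [Wx PW]] := loc i; exists (opensI V W); split=> //.
  exact: subo_trans (@suboIl _ V W) VU.
move=> j; rewrite inE => /orP [/eqP ->|jl]; first exact: mono (@suboIr _ V W) PW.
by apply: mono (@suboIl _ V W) _; apply: PV.
Qed.

Lemma scale_sum_sum (A : comPzRingType) (M : lmodType A) m (a : 'I_m -> A)
    (C : 'I_m -> 'I_m -> A) (x : 'I_m -> M) :
  \sum_k a k *: (\sum_l C k l *: x l) = \sum_l (\sum_k a k * C k l) *: x l.
Proof.
under eq_bigr do rewrite scaler_sumr.
rewrite exchange_big; apply: eq_bigr => l _; rewrite scaler_suml.
by apply: eq_bigr => k _; rewrite scalerA.
Qed.

Section Combinations.
Context (K : comPzRingType) (X : ringedSpace K).
Implicit Types U V W N : opens X.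

Lemma mres_sum (E : sheafMod X) U V (h : subo V U) m (s : 'I_m -> E U) :
  mres h (\sum_i s i) = \sum_i mres h (s i).
Proof. by apply: (big_morph (mres h)); [apply: mresD|apply: mres0]. Qed.

(** Meant for opens with the same points but different presentations, such as [opensI U W] and [U]
    when [U] lies in [W]; it avoids transport along an equality of opens. *)
Lemma mres_inj (E : sheafMod X) U V (h : subo V U) (s t : E U) :
  subo U V -> mres h s = mres h t -> s = t.
Proof.
move=> k e; rewrite -(mres_id (@subo_refl _ U) s) -(mres_id (@subo_refl _ U) t).
by rewrite -!(mres_comp h k) e.
Qed.

Lemma res_inj (U V : opens X) (h : subo V U) (s t : OX U) :
  subo U V -> res h s = res h t -> s = t.
Proof. exact: (@mres_inj (structMod X)). Qed.

Section Lcomb.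
Context (E : sheafMod X) (m : nat).

Definition lcomb U V (h : subo V U) (e : 'I_m -> E U) (a : 'I_m -> OX V) : E V :=
  \sum_i a i *: mres h (e i).

Lemma mres_lcomb U V W (h : subo V U) (k : subo W V) (l : subo W U) e a :
  mres k (lcomb h e a) = lcomb l e (fun i => res k (a i)).
Proof.
by rewrite mres_sum; apply: eq_bigr => i _; rewrite mresZ (mres_comp h k l).
Qed.

Lemma lcomb_mres U V W (h : subo V U) (k : subo W V) (l : subo W U) e a :
  lcomb k (fun i => mres h (e i)) a = lcomb l e a.
Proof. by apply: eq_bigr => i _; rewrite (mres_comp h k l). Qed.

Lemma lcomb_eq U V (h k : subo V U) e a b :
  (forall i, a i = b i) -> lcomb h e a = lcomb k e b.
Proof. by move=> ab; apply: eq_bigr => i _; rewrite ab (Prop_irrelevance h k). Qed.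

Lemma lcombD U V (h : subo V U) e a b :
  lcomb h e a + lcomb h e b = lcomb h e (fun i => a i + b i).
Proof. by rewrite -big_split; apply: eq_bigr => i _; rewrite scalerDl. Qed.

Lemma lcombZ U V (h : subo V U) e c a :
  c *: lcomb h e a = lcomb h e (fun i => c * a i).
Proof. by rewrite scaler_sumr; apply: eq_bigr => i _; rewrite scalerA. Qed.

Lemma lcombB U V (h : subo V U) e a b :
  lcomb h e a - lcomb h e b = lcomb h e (fun i => a i - b i).
Proof. by rewrite -sumrB; apply: eq_bigr => i _; rewrite scalerBl. Qed.

Lemma lcomb0 U V (h : subo V U) e : lcomb h e (fun=> 0) = 0.
Proof. by rewrite /lcomb big1 // => i _; rewrite scale0r. Qed.

Lemma lcomb_delta U V (h : subo V U) e i :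
  lcomb h e (fun j => (i == j)%:R) = mres h (e i).
Proof.
rewrite /lcomb (bigD1 i) //= eqxx scale1r big1 ?addr0 // => j.
by rewrite eq_sym => /negPf ->; rewrite scale0r.
Qed.

(** Freeness is required over every smaller open set: this is an isomorphism of sheaves over [U],
    not only of sections over [U]. *)
Definition basis_on U (e : 'I_m -> E U) : Prop :=
  forall V (h : subo V U), (forall s : E V, exists a, s = lcomb h e a) /\
    (forall a, lcomb h e a = 0 -> forall i, a i = 0).

(* By Nakayama, independence modulo the nilradical makes the number of generators
   minimal. *)
Definition minimal_generators U (g : 'I_m -> E U) : Prop :=
  generates g /\ forall V (h : subo V U) a,
    idealMul (nilradical X) (fullMod E) V (lcomb h g a) ->
    forall i, nilradical X V (a i).

Lemma basis_on_inj U (e : 'I_m -> E U) V (h : subo V U) a b :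
  basis_on e -> lcomb h e a = lcomb h e b -> forall i, a i = b i.
Proof.
move=> eb ab i; apply/eqP; rewrite -subr_eq0; apply/eqP.
by apply: ((eb V h).2 (fun i => a i - b i)); rewrite -lcombB ab subrr.
Qed.

Lemma basis_on_res U V (h : subo V U) (e : 'I_m -> E U) :
  basis_on e -> basis_on (fun i => mres h (e i)).
Proof.
move=> eb W k; have [ex inj] := eb W (subo_trans k h).
split=> [s|a]; last by rewrite (lcomb_mres _ _ (subo_trans k h)) => /inj.
by have [a ->] := ex s; exists a; rewrite (lcomb_mres _ _ (subo_trans k h)).
Qed.

Lemma minimal_generators_res U V (h : subo V U) (g : 'I_m -> E U) :
  minimal_generators g -> minimal_generators (fun i => mres h (g i)).
Proof.
move=> [gen ind]; split=> [W k t x Wx|W k a]; last first.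
  by rewrite (lcomb_mres _ _ (subo_trans k h)) => /ind.
have [N [l [l' [Nx [a e]]]]] := gen W (subo_trans k h) t x Wx.
exists N, l, (subo_trans l k); split=> //; exists a; rewrite e.
by apply: eq_bigr => i _; rewrite (mres_comp h _ l').
Qed.

Lemma basis_change U (e : 'I_m -> E U) (A C : 'M[OX U]_m) :
  A *m C = 1%:M -> C *m A = 1%:M -> basis_on e ->
  basis_on (fun k => \sum_l C k l *: e l).
Proof.
move=> AC CA eb V h; have [ex inj] := eb V h.
pose r (M : 'M[OX U]_m) k l := res h (M k l).
have rM (M N : 'M[OX U]_m) k l : M *m N = 1%:M -> \sum_i r M k i * r N i l = (k == l)%:R.
  move=> MN; have := congr1 (fun Q : 'M_m => res h (Q k l)) MN.
  rewrite !mxE rmorph_sum rmorph_nat => <-.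
  by apply: eq_bigr => i _; rewrite rmorphM.
have E1 a : lcomb h (fun k => \sum_l C k l *: e l) a =
    lcomb h e (fun l => \sum_k a k * r C k l).
  rewrite /lcomb -scale_sum_sum; apply: eq_bigr => k _; congr (_ *: _).
  by rewrite mres_sum; apply: eq_bigr => l _; rewrite mresZ.
have mulK (M N : 'M[OX U]_m) (b : 'I_m -> OX V) l : M *m N = 1%:M ->
    \sum_i (\sum_k b k * r M k i) * r N i l = b l.
  move=> MN; under eq_bigr do rewrite mulr_suml.
  rewrite exchange_big (bigD1 l) //= [X in _ + X]big1 ?addr0.
    under eq_bigr do rewrite -mulrA.
    by rewrite -mulr_sumr rM // eqxx mulr1.
  move=> k kl; under eq_bigr do rewrite -mulrA.
  by rewrite -mulr_sumr rM // (negPf kl) mulr0.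
split=> [s|a]; last first.
  by rewrite E1 => /inj a0 i; rewrite -(mulK C A a i CA) big1 // => j _; rewrite a0 mul0r.
have [b ->] := ex s; exists (fun l => \sum_k b k * r A k l); rewrite E1.
by apply: lcomb_eq => l; rewrite mulK.
Qed.

End Lcomb.

Lemma mor_lcomb (E F : sheafMod X) (f : modMor E F) m U V (h : subo V U)
    (e : 'I_m -> E U) a : f V (lcomb h e a) = lcomb h (fun i => f U (e i)) a.
Proof. by rewrite linear_sum; apply: eq_bigr => i _; rewrite linearZ /= mor_res. Qed.

Lemma common_expansion (E : sheafMod X) m d U V (g : 'I_m -> E V) (s : 'I_d -> E U) x :
  U x -> V x -> generates g ->
  exists N (h : subo N U) (k : subo N V) (M : 'M[OX N]_(d, m)), N x /\
    forall i, mres h (s i) = lcomb k g (M i).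
Proof.
move=> Ux Vx gen.
pose P i N := exists (h : subo N U) (k : subo N V) a, mres h (s i) = lcomb k g a.
have [||N [Nx _ PN]] := @common_nbhd X _ (opensI U V) x P (conj Ux Vx).
- move=> i N N' n [h [k [a e]]].
  exists (subo_trans n h), (subo_trans n k), (fun j => res n (a j)).
  by rewrite -(mres_comp h n) e (mres_lcomb _ _ (subo_trans n k)).
- move=> i; have [|N [h [k [Nx [a e]]]]] :=
    gen (opensI U V) (@suboIr _ U V) (mres (@suboIl _ U V) (s i)) x; first by split.
  exists N; split=> //; exists (subo_trans h (@suboIl _ U V)), k, a.
  by rewrite -(mres_comp (@suboIl _ U V) h).
(* The inclusions of [N] are read off from the index [ord0]; with no index at all, the whole
   intersection serves. *)
rewrite {}/P in PN; case: d s PN => [|d] s PN.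
  have NU : subo (opensI U V) U := @suboIl _ U V.
  by exists (opensI U V), NU, (@suboIr _ U V), 0; split; [split|case].
have [h [k _]] := PN ord0.
have /choice [a ae] i : exists a, mres h (s i) = lcomb k g a.
  have [h' [k' [a e]]] := PN i; exists a.
  by rewrite (Prop_irrelevance h h') e; apply: lcomb_eq.
exists N, h, k, (\matrix_(i, j) a i j); split=> // i; rewrite ae.
by apply: lcomb_eq => j; rewrite mxE.
Qed.

(* The transition matrix between two systems of minimal generators is invertible
   modulo the nilradical, hence invertible, so it can be absorbed in [e]. *)
Lemma adapted_basis (E F : sheafMod X) (f : modMor F E) m U V
    (e : 'I_m -> F U) (g : 'I_m -> E V) y : U y -> V y ->
  basis_on e -> minimal_generators (fun i => f U (e i)) -> minimal_generators g ->
  exists N (h : subo N V) (e' : 'I_m -> F N),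
    [/\ N y, basis_on e' & forall i, f N (e' i) = mres h (g i)].
Proof.
move=> Uy Vy eb [feg _] [gg gind].
have [N1 [h1 [k1 [A [N1y eA]]]]] := common_expansion (fun i => f U (e i)) Uy Vy gg.
have [N2 [h2 [k2 [B [N2y eB]]]]] := common_expansion g Vy Uy feg.
pose N := opensI N1 N2; have Ny : N y by split.
have n1 : subo N N1 := @suboIl _ N1 N2; have n2 : subo N N2 := @suboIr _ N1 N2.
have NU : subo N U := subo_trans n1 h1; have NV : subo N V := subo_trans n1 k1.
pose A' := map_mx (res n1) A; pose B' := map_mx (res n2) B.
have eA' i : mres NU (f U (e i)) = lcomb NV g (A' i).
  rewrite -(mres_comp h1 n1) eA (mres_lcomb _ _ NV).
  by apply: lcomb_eq => j; rewrite mxE.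
have eB' i : mres NV (g i) = lcomb NU (fun i => f U (e i)) (B' i).
  rewrite -(mres_comp h2 n2 NV) eB (mres_lcomb _ _ NU).
  by apply: lcomb_eq => j; rewrite mxE.
(* The rows of B'A' - 1 are relations between the [g i], so minimality puts its entries in the
   nilradical. *)
have BA : nilradical X N (\det (B' *m A') - 1).
  apply: ideal_det1; [exact: smem0|exact: (@smemD _ _ _ (nilradical X) N)|
    exact: (@smemZ _ _ _ (nilradical X) N)|].
  move=> i j; apply: (gind N NV (fun j => (B' *m A') i j - (i == j)%:R)).
  suff -> : lcomb NV g (fun j => (B' *m A') i j - (i == j)%:R) = 0 by apply: smem0.
  rewrite -lcombB lcomb_delta eB'; apply/eqP; rewrite subr_eq0; apply/eqP.
  rewrite /lcomb; under [RHS]eq_bigr do rewrite eA'.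
  by rewrite scale_sum_sum; apply: eq_bigr => l _; rewrite mxE.
(* Membership in the nilradical is only local nilpotency; on [N'] a single exponent works. There det
   B' det A' is a unit, hence so is det A', and its adjugate yields the inverse [C]. *)
have [N' [n' [N'y [k]]]] := BA y Ny; rewrite rmorphB rmorph1 => /unipotent_unit [b].
rewrite det_mulmx rmorphM -mulrA mulrCA => dA.
pose A2 := map_mx (res n') A'; pose C := (res n' (\det B') * b) *: \adj A2.
have dA2 : \det A2 * (res n' (\det B') * b) = 1 by rewrite det_map_mx.
have AC : A2 *m C = 1%:M by rewrite -scalemxAr mul_mx_adj scale_scalar_mx mulrC dA2.
have CA : C *m A2 = 1%:M by rewrite -scalemxAl mul_adj_mx scale_scalar_mx mulrC dA2.
exists N', (subo_trans n' NV), (fun i => \sum_l C i l *: mres (subo_trans n' NU) (e l)).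
split=> //; first by apply: basis_change AC CA _; apply: basis_on_res.
move=> i; rewrite linear_sum.
have E1 l : f N' (C i l *: mres (subo_trans n' NU) (e l)) =
    C i l *: \sum_p A2 l p *: mres (subo_trans n' NV) (g p).
  rewrite linearZ /= mor_res -(mres_comp NU n') eA' (mres_lcomb _ _ (subo_trans n' NV)).
  by congr (_ *: _); apply: lcomb_eq => j; rewrite [RHS]mxE.
under eq_bigr do rewrite E1.
rewrite scale_sum_sum -(lcomb_delta (subo_trans n' NV) g i); apply: lcomb_eq => l.
by have := congr1 (fun Q : 'M_m => Q i l) CA; rewrite !mxE.
Qed.

End Combinations.

(** * Gluing a module with a free module *)

Section Gluing.
Context (K : comPzRingType) (X : ringedSpace K) (E F : sheafMod X) (f : modMor F E).
Context (V W : opens X) (m : nat) (g : 'I_m -> E V).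
Context (e : 'I_m -> F (opensI V W)).
Implicit Types U N : opens X.
Hypothesis eb : basis_on e.
Hypothesis fe : forall i, f _ (e i) = mres (@suboIl _ V W) (g i).

(* A section over [U] of the module glued from F|_W and O^m|_V along V :&: W,
   stored with its image in E, so that the morphism to E is a projection. *)
Record glued U := Glued {
  glF : F (opensI U W);
  glO : 'I_m -> OX (opensI U V);
  glE : E U;
  glFE : f _ glF = mres (@suboIl _ U W) glE;
  glOE : lcomb (@suboIr _ U V) g glO = mres (@suboIl _ U V) glE;
  glFO : forall N (h : subo N (opensI U W)) (k : subo N (opensI U V))
    (l : subo N (opensI V W)), mres h glF = lcomb l e (fun i => res k (glO i))
}.

Lemma glued_ext U (z z' : glued U) :
  glF z = glF z' -> (forall i, glO z i = glO z' i) -> glE z = glE z' -> z = z'.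
Proof.
case: z z' => [s u t p1 p2 p3] [s' u' t' q1 q2 q3] /= es eu et.
have {}eu : u = u' by apply/funext.
by subst s' u' t'; congr Glued; apply: Prop_irrelevance.
Qed.

HB.instance Definition _ U := gen_eqMixin (glued U).
HB.instance Definition _ U := gen_choiceMixin (glued U).

Section Module.
Context (U : opens X).

Program Definition glued0 : glued U :=
  @Glued U 0 (fun=> 0) 0 _ _ _.
Next Obligation. by rewrite linear0 mres0. Qed.
Next Obligation. by rewrite lcomb0 mres0. Qed.
Next Obligation.
by move=> N h k l; rewrite mres0 -(lcomb0 l e); apply: lcomb_eq => i; rewrite rmorph0.
Qed.

Program Definition gluedD (y z : glued U) : glued U :=
  @Glued U (glF y + glF z) (fun i => glO y i + glO z i) (glE y + glE z) _ _ _.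
Next Obligation. by move=> y z; rewrite linearD !glFE mresD. Qed.
Next Obligation. by move=> y z; rewrite -lcombD !glOE mresD. Qed.
Next Obligation.
by move=> y z N h k l; rewrite mresD !(glFO _ h k l) lcombD; apply: lcomb_eq => i; rewrite rmorphD.
Qed.

Program Definition gluedZ (a : OX U) (z : glued U) : glued U :=
  @Glued U (res (@suboIl _ U W) a *: glF z) (fun i => res (@suboIl _ U V) a * glO z i)
    (a *: glE z) _ _ _.
Next Obligation. by move=> a z; rewrite linearZ /= glFE mresZ. Qed.
Next Obligation. by move=> a z; rewrite -lcombZ glOE mresZ. Qed.
Next Obligation.
move=> a z N h k l; rewrite mresZ (glFO _ h k l) lcombZ; apply: lcomb_eq => i.
by rewrite rmorphM !(res_comp _ _ (subo_trans h (@suboIl _ U W))).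
Qed.

Definition gluedN (z : glued U) : glued U := gluedZ (-1) z.

Lemma gluedA : associative gluedD.
Proof. by move=> x y z; apply: glued_ext => [|i|]; apply: addrA. Qed.

Lemma gluedC : commutative gluedD.
Proof. by move=> x y; apply: glued_ext => [|i|]; apply: addrC. Qed.

Lemma glued0D : left_id glued0 gluedD.
Proof. by move=> x; apply: glued_ext => [|i|]; apply: add0r. Qed.

Lemma gluedND : left_inverse glued0 gluedN gluedD.
Proof.
move=> z; apply: glued_ext => [|i|] /=; rewrite ?rmorphN ?rmorph1 ?scaleN1r ?mulN1r;
  exact: addNr.
Qed.

HB.instance Definition _ :=
  GRing.isZmodule.Build (glued U) gluedA gluedC glued0D gluedND.

Lemma gluedZA a b z : gluedZ a (gluedZ b z) = gluedZ (a * b) z.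
Proof.
by apply: glued_ext => [|i|] /=; rewrite ?rmorphM ?scalerA ?mulrA.
Qed.

Lemma gluedZ1 : left_id 1 gluedZ.
Proof. by move=> z; apply: glued_ext => [|i|] /=; rewrite ?rmorph1 ?scale1r ?mul1r. Qed.

Lemma gluedZDr : right_distributive gluedZ +%R.
Proof. by move=> a y z; apply: glued_ext => [|i|] /=; rewrite ?scalerDr ?mulrDr. Qed.

Lemma gluedZDl (z : glued U) : {morph gluedZ^~ z : a b / a + b}.
Proof.
by move=> a b; apply: glued_ext => [|i|] /=; rewrite ?rmorphD ?scalerDl ?mulrDl.
Qed.

HB.instance Definition _ :=
  GRing.Zmodule_isLmodule.Build (OX U) (glued U) gluedZA gluedZ1 gluedZDr gluedZDl.

End Module.

Lemma opensIS U U' N : subo U' U -> subo (opensI U' N) (opensI U N).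
Proof. by move=> h x [/h]. Qed.

Section Restriction.
Context (U U' : opens X) (h : subo U' U).

Program Definition glued_res (z : glued U) : glued U' :=
  @Glued U' (mres (@opensIS U U' W h) (glF z))
    (fun i => res (@opensIS U U' V h) (glO z i)) (mres h (glE z)) _ _ _.
Next Obligation.
by move=> z; rewrite mor_res glFE !(mres_comp _ _ (subo_trans (@suboIl _ U' W) h)).
Qed.
Next Obligation.
move=> z; rewrite -(mres_lcomb (@suboIr _ U V)) glOE.
by rewrite !(mres_comp _ _ (subo_trans (@suboIl _ U' V) h)).
Qed.
Next Obligation.
move=> z N h0 k l; rewrite (mres_comp _ _ (subo_trans h0 (@opensIS U U' W h))).
rewrite (glFO z _ (subo_trans k (@opensIS U U' V h)) l).
by apply: lcomb_eq => i; rewrite (res_comp _ k (subo_trans k (@opensIS U U' V h))).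
Qed.

Lemma glued_resD y z : glued_res (y + z) = glued_res y + glued_res z.
Proof. by apply: glued_ext => [|i|] /=; rewrite ?mresD ?rmorphD. Qed.

Lemma glued_resZ a z : glued_res (a *: z) = res h a *: glued_res z.
Proof.
apply: glued_ext => [|i|] /=; rewrite ?mresZ ?rmorphM //.
  by rewrite !(res_comp _ _ (subo_trans (@suboIl _ U' W) h)).
by rewrite !(res_comp _ _ (subo_trans (@suboIl _ U' V) h)).
Qed.

End Restriction.

Lemma glued_res_id U (h : subo U U) z : glued_res h z = z.
Proof. by apply: glued_ext => [|i|] /=; rewrite ?mres_id ?res_id. Qed.

Lemma glued_res_comp U U' N (h : subo U' U) (k : subo N U') (l : subo N U) z :
  glued_res k (glued_res h z) = glued_res l z.
Proof.
by apply: glued_ext => [|i|] /=; [apply: mres_comp|apply: res_comp|apply: mres_comp].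
Qed.

Lemma glued_res_sep U (y z : glued U) :
  (forall x, U x -> exists U' (h : subo U' U), U' x /\ glued_res h y = glued_res h z) ->
  y = z.
Proof.
move=> H; apply: glued_ext => [|i|].
- apply: mres_sep => x [/H [U' [h [U'x e']]] Wx].
  by exists (opensI U' W), (opensIS h); split=> //; apply: (congr1 (@glF _) e').
- apply: res_sep => x [/H [U' [h [U'x e']]] Vx].
  exists (opensI U' V), (opensIS h); split=> //.
  exact: (congr1 (fun z : glued U' => glO z i) e').
apply: mres_sep => x /H [U' [h [U'x e']]]; exists U', h; split=> //.
exact: (congr1 (@glE _) e').
Qed.

Lemma glued_glue U (I : Type) (P : I -> opens X) (h : forall i, subo (P i) U)
    (z : forall i, glued (P i)) :
  (forall x, U x -> exists i, P i x) ->
  (forall i j N (hi : subo N (P i)) (hj : subo N (P j)),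
     glued_res hi (z i) = glued_res hj (z j)) ->
  exists t : glued U, forall i, glued_res (h i) t = z i.
Proof.
move=> cov comp.
have compF i j N (hi : subo N (opensI (P i) W)) (hj : subo N (opensI (P j) W)) :
    mres hi (glF (z i)) = mres hj (glF (z j)).
  have NW : subo N (opensI N W) by move=> x Nx; split=> //; have [] := hi x Nx.
  have := congr1 (fun y => mres NW (glF y)) (comp i j N
    (subo_trans hi (@suboIl _ _ W)) (subo_trans hj (@suboIl _ _ W))).
  by rewrite /= (mres_comp _ _ hi) (mres_comp _ _ hj).
have compO k i j N (hi : subo N (opensI (P i) V)) (hj : subo N (opensI (P j) V)) :
    res hi (glO (z i) k) = res hj (glO (z j) k).
  have NV : subo N (opensI N V) by move=> x Nx; split=> //; have [] := hi x Nx.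
  have := congr1 (fun y => res NV (glO y k)) (comp i j N
    (subo_trans hi (@suboIl _ _ V)) (subo_trans hj (@suboIl _ _ V))).
  by rewrite /= (res_comp _ _ hi) (res_comp _ _ hj).
have covI N x : opensI U N x -> exists i, opensI (P i) N x.
  by move=> [/cov [i Px] Nx]; exists i.
have [s sP] := mres_glue (fun i => opensIS (h i)) (covI W) compF.
have /choice [u uP] k := res_glue (fun i => opensIS (h i)) (covI V) (compO k).
have [t tP] : exists t : E U, forall i, mres (h i) t = glE (z i).
  apply: mres_glue cov _ => i j N hi hj.
  exact: (congr1 (@glE _) (comp i j N hi hj)).
have st : f _ s = mres (@suboIl _ U W) t.
  apply: mres_sep => x /covI [i Px]; exists (opensI (P i) W), (opensIS (h i)).
  split=> //; rewrite -mor_res sP glFE -tP.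
  by rewrite !(mres_comp _ _ (subo_trans (@suboIl _ _ W) (h i))).
have ut : lcomb (@suboIr _ U V) g u = mres (@suboIl _ U V) t.
  apply: mres_sep => x /covI [i Px]; exists (opensI (P i) V), (opensIS (h i)).
  split=> //; rewrite (mres_lcomb _ _ (@suboIr _ (P i) V)).
  rewrite (lcomb_eq _ (@suboIr _ (P i) V) _ (fun k => uP k i)) glOE -tP.
  by rewrite !(mres_comp _ _ (subo_trans (@suboIl _ _ V) (h i))).
have su N (k : subo N (opensI U W)) (k' : subo N (opensI U V))
    (l : subo N (opensI V W)) : mres k s = lcomb l e (fun i => res k' (u i)).
  apply: mres_sep => x Nx; have [i Px] := cov x (k x Nx).1.
  pose M := opensI N (P i); have MN : subo M N := @suboIl _ N (P i).
  have MW : subo M (opensI (P i) W) by move=> y [/k [_ ?] ?].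
  have MV : subo M (opensI (P i) V) by move=> y [/k' [_ ?] ?].
  exists M, MN; split=> //; rewrite (mres_lcomb _ _ (subo_trans MN l)).
  rewrite (mres_comp k MN (subo_trans MW (opensIS (h i)))).
  rewrite -(mres_comp (opensIS (h i)) MW) sP (glFO _ MW MV (subo_trans MN l)).
  apply: lcomb_eq => j; rewrite -uP (res_comp _ _ (subo_trans MV (opensIS (h i)))).
  by rewrite (res_comp _ _ (subo_trans MV (opensIS (h i)))).
exists (Glued st ut su) => i.
by apply: glued_ext => [|k|] /=; [apply: sP|apply: uP|apply: tP].
Qed.

Definition glueMod : sheafMod X :=
  @SheafMod K X (fun U => glued U : lmodType (OX U)) glued_res glued_resD glued_resZ
    glued_res_id glued_res_comp glued_res_sep glued_glue.

Lemma glE_linear U : linear (@glE U).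
Proof. by []. Qed.

HB.instance Definition _ U :=
  GRing.isLinear.Build (OX U) (glued U) (E U) _ (@glE U) (@glE_linear U).

Definition glue_mor : modMor glueMod E :=
  @ModMor K X glueMod E (fun U => @glE U) (fun U U' h s => erefl).

Lemma glF_lcomb d U N (h : subo N U) (b : 'I_d -> glueMod U) a :
  glF (lcomb h b a : glued N) =
    \sum_i res (@suboIl _ N W) (a i) *: mres (@opensIS U N W h) (glF (b i)).
Proof. exact: (big_morph (@glF N) (id1 := 0) (op1 := +%R)). Qed.

Lemma glO_lcomb d U N (h : subo N U) (b : 'I_d -> glueMod U) a k :
  glO (lcomb h b a : glued N) k =
    \sum_i res (@suboIl _ N V) (a i) * res (@opensIS U N V h) (glO (b i) k).
Proof. exact: (big_morph (fun z : glued N => glO z k) (id1 := 0) (op1 := +%R)). Qed.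

(** Over [W] the glued module is F: the remaining components are the coordinates in the basis [e]
    and the image under [f]. Existence is [glued_exF]. *)
Lemma glued_eqF U (y z : glued U) : subo U W -> glF y = glF z -> y = z.
Proof.
move=> UW yz; apply: glued_ext => //.
  have h : subo (opensI U V) (opensI U W) by move=> x [/[dup] Ux /UW ? ?].
  have l : subo (opensI U V) (opensI V W) by move=> x [/UW ? ?].
  move=> i; rewrite -(res_id (@subo_refl _ _) (glO y i)).
  rewrite -(res_id (@subo_refl _ _) (glO z i)); move: i.
  by apply: (basis_on_inj (h := l) eb); rewrite -!(glFO _ h) yz.
by apply: (mres_inj (h := @suboIl _ U W)); [move=> x Ux; split=> //; apply: UW|rewrite -!glFE yz].
Qed.

(** Over [V] the glued module is free of rank [m]: the F-component is the combination of the [e i]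
    with the given coefficients, and the E-component that of the [g i]. Existence is [glued_exO]. *)
Lemma glued_eqO U (y z : glued U) :
  subo U V -> (forall i, glO y i = glO z i) -> y = z.
Proof.
move=> UV yz; apply: glued_ext => //.
  have k : subo (opensI U W) (opensI U V) by move=> x [/[dup] Ux /UV ? ?].
  have l : subo (opensI U W) (opensI V W) by move=> x [/UV ? ?].
  rewrite -(mres_id (@subo_refl _ _) (glF y)) -(mres_id (@subo_refl _ _) (glF z)).
  by rewrite !(glFO _ _ k l); apply: lcomb_eq => i; rewrite yz.
apply: (mres_inj (h := @suboIl _ U V)); first by move=> x Ux; split=> //; apply: UV.
by rewrite -!glOE; apply: lcomb_eq.
Qed.

Lemma glued_exF U (s : F U) : subo U W ->
  exists z : glueMod U, glF z = mres (@suboIl _ U W) s /\ glE z = f U s.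
Proof.
move=> UW; have l : subo (opensI U V) (opensI V W) by move=> x [/UW ? ?].
have [ex _] := eb l; have [u uP] := ex (mres (@suboIl _ U V) s).
have sE : f _ (mres (@suboIl _ U W) s) = mres (@suboIl _ U W) (f U s) by rewrite mor_res.
have uE : lcomb (@suboIr _ U V) g u = mres (@suboIl _ U V) (f U s).
  rewrite -mor_res uP mor_lcomb -(lcomb_mres (@suboIl _ V W) l).
  by apply: eq_bigr => i _; rewrite fe.
have su N (h : subo N (opensI U W)) (k : subo N (opensI U V)) (l' : subo N (opensI V W)) :
    mres h (mres (@suboIl _ U W) s) = lcomb l' e (fun i => res k (u i)).
  rewrite -(mres_lcomb l) -uP.
  by rewrite !(mres_comp _ _ (subo_trans h (@suboIl _ U W))).
by exists (Glued sE uE su).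
Qed.

Lemma glued_exO U (u : 'I_m -> OX U) (UV : subo U V) :
  exists z : glueMod U, (forall i, glO z i = res (@suboIl _ U V) (u i)) /\
    glE z = lcomb UV g u.
Proof.
have l : subo (opensI U W) (opensI V W) by move=> x [/UV ? ?].
pose s := lcomb l e (fun i => res (@suboIl _ U W) (u i)).
have sE : f _ s = mres (@suboIl _ U W) (lcomb UV g u).
  rewrite mor_lcomb (mres_lcomb _ _ (subo_trans (@suboIl _ U W) UV)).
  by apply: eq_bigr => i _; rewrite fe (mres_comp _ _ (subo_trans (@suboIl _ U W) UV)).
have uE : lcomb (@suboIr _ U V) g (fun i => res (@suboIl _ U V) (u i)) =
    mres (@suboIl _ U V) (lcomb UV g u).
  by rewrite (mres_lcomb _ _ (@suboIr _ U V)).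
have su N (h : subo N (opensI U W)) (k : subo N (opensI U V)) (l' : subo N (opensI V W)) :
    mres h s = lcomb l' e (fun i => res k (res (@suboIl _ U V) (u i))).
  rewrite (mres_lcomb _ _ l'); apply: lcomb_eq => i.
  by rewrite !(res_comp _ _ (subo_trans h (@suboIl _ U W))).
by exists (Glued sE uE su).
Qed.

Lemma glue_basis_left U (b : 'I_m -> F U) : subo U W -> basis_on b ->
  exists c : 'I_m -> glueMod U, basis_on c /\ forall i, glue_mor U (c i) = f U (b i).
Proof.
move=> UW bb; have /choice [c cP] i := glued_exF (b i) UW; exists c; split; last first.
  by move=> i; apply: (cP i).2.
move=> N h; have NW := subo_trans h UW; have r : subo N (opensI N W) by move=> x /[dup] /NW.
have E1 a : glF (lcomb h c a : glued N) = mres (@suboIl _ N W) (lcomb h b a).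
  rewrite glF_lcomb (mres_lcomb _ _ (subo_trans (@suboIl _ N W) h)).
  apply: eq_bigr => i _; rewrite (cP i).1; congr (_ *: _).
  by rewrite (mres_comp _ _ (subo_trans (@suboIl _ N W) h)).
have [ex inj] := bb N h; split=> [z|a a0].
  have [a sa] := ex (mres r (glF (z : glued N))); exists a; apply: glued_eqF => //.
  by rewrite E1 -sa (mres_comp _ _ (@subo_refl _ _)) mres_id.
apply: inj; apply: (mres_inj (h := @suboIl _ N W)) => //.
by rewrite -E1 a0 mres0.
Qed.

Lemma glue_basis_right : exists c : 'I_m -> glueMod V,
  basis_on c /\ forall i, glue_mor V (c i) = g i.
Proof.
have /choice [c cP] i := glued_exO (fun j => (i == j)%:R) (@subo_refl _ V).
exists c; split; last by move=> i; rewrite [LHS](cP i).2 lcomb_delta mres_id.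
move=> N h; have r : subo N (opensI N V) by move=> x /[dup] /h.
have E1 a k : glO (lcomb h c a : glued N) k = res (@suboIl _ N V) (a k).
  rewrite glO_lcomb (bigD1 k) //= big1 => [|i ik]; rewrite (cP _).1.
    by rewrite eqxx !rmorph1 mulr1 addr0.
  by rewrite (negPf ik) !rmorph0 mulr0.
split=> [z|a a0 i].
  exists (fun i => res r (glO (z : glued N) i)); apply: glued_eqO => // i.
  by rewrite E1 (res_comp _ _ (@subo_refl _ _)) res_id.
by apply: (res_inj (h := @suboIl _ N V)) => //; rewrite -E1 a0 rmorph0.
Qed.

End Gluing.

(** * Minimal generators of quasi locally free sheaves *)

Section QuasiLocallyFree.
Context (K : comPzRingType) (X : ringedSpace K).
Implicit Types U V W : opens X.

Lemma idealPow_sub (J : idealSheaf X) i U (s : structMod X U) : idealPow J i.+1 U s -> J U s.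
Proof.
move=> Js; apply: smem_loc => x /Js [V [h [Vx [n [a [b [Ja _ e]]]]]]].
exists V, h; split=> //; rewrite e.
apply: (big_ind (fun s : structMod X V => J V s)).
- exact: smem0.
- by move=> *; apply: smemD.
by move=> k _; rewrite [_ *: _]mulrC; apply: (@smemZ _ _ _ J V (b k)).
Qed.

(** Once the [q k] are lifted locally to sections [b k] of the structure sheaf, [s] differs from the
    combination of the [b k] by a section of the power [i.+1] of [J], which is contained in [J]
    because the exponent is positive. *)
Lemma quot_rep_in_ideal (J : idealSheaf X) i U (s : structMod X U) n
    (c : 'I_n -> OX U) (q : 'I_n -> structC X i.+1 U) :
  J = nilradical X -> (forall k, J U (c k)) ->
  quot_proj _ U s = \sum_k c k *: q k -> J U s.
Proof.
move=> -> {J} Jc e; pose J := nilradical X; apply: (@smem_loc _ _ _ J) => x Ux.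
pose P k V := exists (h : subo V U) b, quot_proj (idealPow J i.+1) V b = mres h (q k).
have [|k|V [Vx VU PV]] := @common_nbhd X _ U x P Ux.
- move=> k V W h [l [b eb]]; exists (subo_trans h l), (mres h b).
  by rewrite mor_res eb (mres_comp l h (subo_trans h l)).
- have [V [h [Vx [b eb]]]] := @quot_projP _ _ _ (idealPow J i.+1) U (q k) x Ux.
  by exists V; split=> //; exists h, b.
have /choice [b eb] k : exists b, quot_proj (idealPow J i.+1) V b = mres VU (q k).
  by have [h [b eb]] := PV k; exists b; rewrite eb (Prop_irrelevance h VU).
exists V, VU; split=> //.
have /quot_proj_eq0 /idealPow_sub : quot_proj (idealPow J i.+1) V
    (mres VU s - \sum_k res VU (c k) *: b k) = 0.
  rewrite linearB mor_res e mres_sum linear_sum; apply/eqP; rewrite subr_eq0; apply/eqP.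
  by apply: eq_bigr => k _; rewrite mresZ linearZ /= eb.
move=> Jd; rewrite -[mres VU s](subrK (\sum_k res VU (c k) *: b k)).
apply: smemD => //; apply: (big_ind (fun s : structMod X V => J V s)).
- exact: smem0.
- by move=> *; apply: smemD.
move=> k _; rewrite [_ *: _]mulrC; apply: (@smemZ _ _ _ J V (b k)).
exact: (@smem_res _ _ _ J).
Qed.

Lemma dsum_sumE (I : finType) (F : I -> sheafMod X) U n (s : 'I_n -> dsumMod F U) i :
  (\sum_k s k : dsumMod F U) i = \sum_k s k i.
Proof. exact: (big_morph (fun u : dsumMod F U => u i) (id1 := 0) (op1 := +%R)). Qed.

(** The generators correspond to the unit sections of the summands. Their number is the sum of the
    multiplicities, which do not depend on the point. *)
Lemma qlf_minimal_generators n (E : sheafMod X) : quasi_locally_free n E ->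
  exists m, forall x : X, exists U (g : 'I_m -> E U), U x /\ minimal_generators g.
Proof.
move=> [_ [m loc]]; pose T : finType := {i : 'I_n & 'I_(m i)}; exists #|{: T}| => x.
have [U [Ux [f [fbij fres]]]] := loc x; pose F (t : T) := structC X (tag t).+1.
pose proj (t : T) := quot_proj (idealPow (nilradical X) (tag t).+1).
have [psi _ psiK] := fbij U (@subo_refl _ U).
pose delta t : dsumMod F U := fun t' => proj t' U (t == t')%:R.
pose g (k : 'I_#|{: T}|) := psi (delta (enum_val k)).
(* Through [f], a combination of the generators has as its coordinates the classes of its
   coefficients. *)
have fg V (h : subo V U) a t : f V h (lcomb h g a) t = proj t V (a (enum_rank t)).
  rewrite linear_sum dsum_sumE.
  transitivity (\sum_k proj t V (a k * (enum_val k == t)%:R)).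
    apply: eq_bigr => k _; rewrite linearZ /= (fres _ _ (@subo_refl _ U) h h) psiK.
    rewrite [LHS](_ : _ = a k *: proj t V ((enum_val k == t)%:R)) ?linearZ //.
    congr (_ *: _); rewrite [LHS](_ : _ = mres h (proj t U (enum_val k == t)%:R)) //.
    by rewrite -mor_res [mres h _]rmorph_nat.
  rewrite -linear_sum (bigD1 (enum_rank t)) //= enum_rankK eqxx mulr1 big1 ?addr0 //.
  by move=> k kt; rewrite (can2_eq enum_valK enum_rankK) (negPf kt) mulr0.
exists U, g; split=> //; split=> [V h s y Vy|V h a Ia k].
  pose P t W := exists (l : subo W V) b, proj t W b = mres l (f V h s t).
  have [|t|W [Wy WV PW]] := @common_nbhd X _ V y P Vy.
  - move=> t W N k [l [b eb]]; exists (subo_trans k l), (mres k b).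
    by rewrite mor_res eb (mres_comp l k (subo_trans k l)).
  - have [W [l [Wy [b eb]]]] := @quot_projP _ _ _ (idealPow (nilradical X) (tag t).+1)
      V (f V h s t) y Vy.
    by exists W; split=> //; exists l, b.
  have /choice [b eb] t : exists b, proj t W b = mres WV (f V h s t).
    by have [l [b eb]] := PW t; exists b; rewrite eb (Prop_irrelevance l WV).
  exists W, WV, (subo_trans WV h); split=> //; exists (fun k => b (enum_val k)).
  apply: (bij_inj (fbij W (subo_trans WV h))); rewrite (fres _ _ h).
  apply: functional_extensionality_dep => t.
  by rewrite [RHS](fg _ _ (fun k => b (enum_val k))) enum_rankK eb.
(* Independence is checked one coordinate at a time: the class of [a k] is a combination with
   coefficients in the nilradical. *)
apply: smem_loc => y Vy; have [W [l [Wy [d [c [s [Ic _ e]]]]]]] := Ia y Vy.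
exists W, l; split=> //; have Wh := subo_trans l h.
apply: (quot_rep_in_ideal (q := fun j => f W Wh (s j) (enum_val k)) erefl Ic).
have := congr1 (fun u => f W Wh u (enum_val k)) e.
rewrite (mres_lcomb _ _ Wh) fg enum_valK => ->.
by rewrite linear_sum dsum_sumE; apply: eq_bigr => j _; rewrite linearZ.
Qed.

End QuasiLocallyFree.

Section Coordinates.
Context (K : comPzRingType) (X : ringedSpace K) (F : sheafMod X) (m : nat).
Context (U : opens X) (e : 'I_m -> F U) (eb : basis_on e).

Definition coords V (h : subo V U) (s : F V) : freeMod X m V :=
  projT1 (cid ((eb h).1 s)).

Lemma coordsK V (h : subo V U) s : lcomb h e (coords h s) = s.
Proof. exact: (esym (projT2 (cid ((eb h).1 s)))). Qed.

Lemma lcombK V (h : subo V U) a : coords h (lcomb h e a) = a.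
Proof.
apply: functional_extensionality_dep => i.
by apply: (basis_on_inj (h := h) eb); apply: coordsK.
Qed.

Lemma coords_linear V (h : subo V U) : linear (coords h).
Proof.
move=> a s t; rewrite -[in LHS](coordsK h s) -[in LHS](coordsK h t) lcombZ lcombD.
exact: lcombK.
Qed.

HB.instance Definition _ V (h : subo V U) :=
  GRing.isLinear.Build (OX V) (F V) (freeMod X m V) _ (coords h) (@coords_linear V h).

Lemma basis_isomorphic_on : isomorphic_on U F (freeMod X m).
Proof.
exists (fun V h => coords h : {linear F V -> freeMod X m V}); split=> [V h|V W h k l s].
  by exists (lcomb h e); [apply: coordsK|apply: lcombK].
by rewrite /= -[in LHS](coordsK h s) (mres_lcomb h l k); apply: lcombK.
Qed.

End Coordinates.

(** Bijectivity is needed on sections over every open set. Injectivity makes the local preimages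
    agree on overlaps, so they glue. *)
Lemma sheaf_iso_of_inj_surj (K : comPzRingType) (X : ringedSpace K) (A B : sheafMod X)
    (f : modMor A B) :
  (forall U (s : A U), f U s = 0 -> s = 0) -> sheaf_surjective f -> sheaf_iso f.
Proof.
move=> inj0 surj U.
have inj V (s t : A V) : f V s = f V t -> s = t.
  move=> e; apply/eqP; rewrite -subr_eq0; apply/eqP; apply: inj0.
  by rewrite linearB e subrr.
have /choice [g gK] t : exists s, f U s = t.
  pose I := {x : X | U x}.
  have /choice [p pP] (i : I) : exists p : {V : opens X & A V},
      projT1 p (sval i) /\ exists h : subo (projT1 p) U, f _ (projT2 p) = mres h t.
    have [V [h [Vx [s e]]]] := surj U t (sval i) (svalP i).
    by exists (existT _ V s); split=> //; exists h.
  have pU i : subo (projT1 (p i)) U by have [_ [h _]] := pP i.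
  have fp i : f _ (projT2 (p i)) = mres (pU i) t.
    by have [_ [h ->]] := pP i; rewrite (Prop_irrelevance h (pU i)).
  have cov x : U x -> exists i, projT1 (p i) x.
    by move=> Ux; exists (exist _ x Ux); have [] := pP (exist _ x Ux).
  have [|s sP] := @mres_glue _ _ A U I _ pU (fun i => projT2 (p i)) cov.
    move=> i j V hi hj; apply: inj; rewrite !mor_res !fp.
    by rewrite !(mres_comp _ _ (subo_trans hi (pU i))).
  exists s; apply: mres_sep => x /cov [i px]; exists (projT1 (p i)), (pU i).
  by split=> //; rewrite -mor_res sP fp.
by exists g => // s; apply: inj; rewrite gK.
Qed.

(** * Covers by vector bundles *)

Section MinimalCovers.
Context (K : comPzRingType) (X : ringedSpace K) (E : sheafMod X) (m : nat).
Implicit Types U V W : opens X.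

Definition free_cover_at (F : sheafMod X) (f : modMor F E) (x : X) : Prop :=
  exists U (e : 'I_m -> F U),
    [/\ U x, basis_on e & minimal_generators (fun i => f U (e i))].

Lemma free_cover_restrictC (F : sheafMod X) (f : modMor F E) :
  (forall x, free_cover_at f x) ->
  [/\ vector_bundle F, sheaf_surjective f & sheaf_iso (restrictC_mor f)].
Proof.
move=> cover.
have fsurj : sheaf_surjective f.
  move=> V t x Vx; have [U [e [Ux _ [gen _]]]] := cover x.
  have [|W [k [l [Wx [a ea]]]]] :=
    gen (opensI U V) (@suboIl _ U V) (mres (@suboIr _ U V) t) x; first by split.
  exists W, (subo_trans k (@suboIr _ U V)); split=> //; exists (lcomb l e a).
  by rewrite mor_lcomb -(mres_comp (@suboIr _ U V) k).
split=> // [x|].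
  by have [U [e [Ux eb _]]] := cover x; exists U, m; split=> //; apply: basis_isomorphic_on eb.
apply: sheaf_iso_of_inj_surj => [U p p0|U p x Ux]; last first.
  have [V [t [Vx pt]]] := qrep_ex p Ux.
  have [W [h [Wx [s es]]]] := fsurj V t x Vx.
  exists W, (subo_trans h (qrep_sub pt)); split=> //; exists (quot_proj _ W s).
  rewrite quot_mapE es; apply: qsec_eq => y Wy; exists W, (mres h t); split=> //.
    exact: qproj_inT.
  by apply/qresP; split=> //; apply: qrep_res.
apply: (@mres_sep _ _ (restrictC F)) => x Ux; have [V0 [s0 [V0x ps0]]] := qrep_ex p Ux.
have [U1 [e [U1x eb [_ ind]]]] := cover x.
pose V := opensI V0 U1; pose s := mres (@suboIl _ V0 U1) s0.
have ps : p V s by apply: qrep_res.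
have VU : subo V U := qrep_sub ps; exists V, VU; split; first by split.
have epr : mres VU p = quot_proj _ V s.
  apply: (@qsec_eq _ _ _ _ V) => y Vy; exists V, s; split=> //; last exact: qproj_inT.
  by apply/qresP; split=> //; apply: subo_refl.
rewrite mres0 epr; apply/quot_proj_eq0.
have : idealMul (nilradical X) (fullMod E) V (f V s).
  by apply/quot_proj_eq0; rewrite -(quot_mapE (@mor_idealMul _ _ _ _ _ f)) -epr mor_res p0 mres0.
(* The image of [s] lies in I E, so by minimality the coordinates of [s] in the basis lie in I, and
   [s] lies in I F. *)
have [a ->] := (eb V (@suboIr _ V0 U1)).1 s; rewrite mor_lcomb => /ind Ia y Vy.
exists V, (@subo_refl _ V); split=> //; rewrite mres_id.
by exists m, a, (fun i => mres (@suboIr _ V0 U1) (e i)); split.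
Qed.

Lemma free_cover_glue (F : sheafMod X) (f : modMor F E) W V (g : 'I_m -> E V)
    (e : 'I_m -> F (opensI V W)) :
  basis_on e -> (forall i, f _ (e i) = mres (@suboIl _ V W) (g i)) ->
  minimal_generators g -> (forall x, W x -> free_cover_at f x) ->
  exists (F' : sheafMod X) (f' : modMor F' E),
    forall x, W x \/ V x -> free_cover_at f' x.
Proof.
move=> eb fe gmin cover; exists (glueMod f g e), (glue_mor f g e) => x [Wx|Vx].
  have [U [b [Ux bb bmin]]] := cover x Wx; pose N := opensI U W.
  have [c [cb fc]] := glue_basis_left eb fe (@suboIr _ U W : subo N W)
    (basis_on_res (@suboIl _ U W) bb).
  exists N, c; split=> //.
  have -> : (fun i => glue_mor f g e N (c i)) = fun i => mres (@suboIl _ U W) (f U (b i)).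
    by apply/funext => i; rewrite fc mor_res.
  exact: minimal_generators_res.
have [c [cb fc]] := glue_basis_right fe; exists V, c; split=> //.
by have -> : (fun i => glue_mor f g e V (c i)) = g by apply/funext => i; rewrite fc.
Qed.

End MinimalCovers.

Section CurveCovers.
Context (K : fieldType) (X : ringedSpace K) (E : sheafMod X) (m : nat).
Hypothesis Xc : smooth_irreducible_curve (reduction X).
Hypothesis Emin : forall x : X, exists (U : opens X) (g : 'I_m -> E U),
  U x /\ minimal_generators g.

Lemma free_cover_add_point (W : opens X) w (F : sheafMod X) (f : modMor F E) x :
  W w -> (forall y, W y -> free_cover_at m f y) ->
  exists (F' : sheafMod X) (f' : modMor F' E),
    (forall y, W y -> free_cover_at m f' y) /\ free_cover_at m f' x.
Proof.
move=> Ww cover; have [Wx|nWx] := pselect (W x).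
  by exists F, f; split=> //; apply: cover.
have [V [g [Vx gmin]]] := Emin x.
have [||y [Wy Vy]] := Xc.2.2 W V; [by exists w|by exists x|].
have [U [e [Uy eb emin]]] := cover y Wy.
have [N0 [h0 [e0 [N0y e0b fe0]]]] := adapted_basis Uy Vy eb emin gmin.
(* The reduction has the same underlying space as X, so its open sets serve in X. Since x is not in
   [W], the intersection of [V1] with [W] lies in [N0]. *)
have [V1 [V1x V1N]] := @open_adding_point _ _ Xc N0 y x N0y.
pose V' : opens X := opensI V (V1 : opens X).
have N'N : subo (opensI V' W) N0.
  by move=> z [[_ /V1N [//|->]] ].
have [||||F' [f' H]] := @free_cover_glue _ _ E m F f W V' (fun i => mres (@suboIl _ V V1) (g i))
  (fun i => mres N'N (e0 i)).
- exact: basis_on_res.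
- move=> i; rewrite mor_res fe0.
  by rewrite !(mres_comp _ _ (subo_trans (@suboIl _ V' W) (@suboIl _ V V1))).
- exact: minimal_generators_res.
- exact: cover.
by exists F', f'; split=> [z Wz|]; apply: H; [left|right; split].
Qed.

Lemma free_cover_exists : exists (F : sheafMod X) (f : modMor F E),
  forall x, free_cover_at m f x.
Proof.
have [w _] := Xc.2.1; have [W [g [Ww gmin]]] := Emin w.
pose W0 : opens X := Opens open0.
pose idE := @ModMor _ _ E E (fun U => idfun : {linear E U -> E U}) (fun U V h s => erefl).
(* First chart: gluing along the empty set, over which every module is zero and any family is a
   basis. *)
have [||//|//|F0 [f0 F0W]] := @free_cover_glue _ _ E m E idE W0 W g
  (fun i => mres (@suboIl _ W W0) (g i)).
- move=> V h; have V0 : forall s t : E V, s = t.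
    by move=> s t; apply: mres_sep => x /h [].
  split=> [s|a _ i]; first by exists (fun=> 0); apply: V0.
  by apply: (@res_sep _ X) => x /h [].
- by [].
have /finite_seqP [l lP] := @finite_complement _ _ Xc W w Ww.
suff [F [f [FW Fl]]] : exists (F : sheafMod X) (f : modMor F E),
    (forall x, W x -> free_cover_at m f x) /\ (forall x, x \in l -> free_cover_at m f x).
  exists F, f => x; have [/FW//|nWx] := pselect (W x); apply: Fl.
  by have : (~` (W : set X)) x by []; rewrite lP.
elim: l {lP} => [|x l [F [f [FW Fl]]]].
  by exists F0, f0; split=> // x Wx; apply: F0W; right.
(* The whole treated locus is open, so it can play the role of [W] when the next point is added and
   nothing already obtained is lost. *)
have So : open [set y | free_cover_at m f y].
  apply: open_of_local => y [U [e [Uy eb emin]]]; exists U; split=> // z Uz.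
  by exists U, e; split.
have [F' [f' [F'S F'x]]] := @free_cover_add_point (Opens So) w F f x (FW w Ww) (fun y h => h).
exists F', f'; split=> [y /FW Sy|y]; first exact: F'S.
by rewrite inE => /orP [/eqP ->//|/Fl]; apply: F'S.
Qed.
End CurveCovers.

Theorem proposition5p1p1 (R : realType) (n : nat) (Cn : ringedSpace R[i])
    (HCn : primitive_multiple_curve n Cn)
    (E : sheafMod Cn) (HE : quasi_locally_free n E) :
  exists (EE : sheafMod Cn) (f : modMor EE E),
    [/\ vector_bundle EE, sheaf_surjective f & sheaf_iso (restrictC_mor f)].
Proof.
have [m Emin] := qlf_minimal_generators HE.
have [F [f cover]] := free_cover_exists (pmc_curve HCn) Emin.
by exists F, f; apply: free_cover_restrictC cover.
Qed.
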